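(* Let $(M,g)$ be a closed $n$-dimensional Einstein manifold with nonzero scalar curvature $s$, and let $K_{\min}$ be the minimum of its sectional curvature. If $K_{\min}\ge s/n^2$, then $(M,g)$ is not unstable and does not admit (nonzero) infinitesimal Einstein deformations.
   Context: Closed means compact without boundary. An Einstein manifold is a Riemannian manifold of dimension $n\ge2$ with $\mathrm{Ric}=\kappa g$ for a real constant $\kappa$; then $\kappa=s/n$. $\bar\Delta=\nabla^*\nabla=-\mathrm{trace}(\nabla^2)$ is the rough Laplacian of the Levi-Civita connection on symmetric covariant 2-tensor fields $C^\infty(S^2M)$. Curvature components are $R(e_j,e_l)e_k=R^i_{kjl}e_i$, $R_{ijkl}=g_{im}R^m_{jkl}$, $R_{kl}=R^i_{kil}$, with $\sec(e_i\wedge e_j)=R_{ijij}$ for orthonormal $e_i,e_j$. The curvature operator of the second kind is $(\overset{\circ}{R}\varphi)_{ij}=R_{ikjl}\varphi^{kl}$, and the Einstein operator is $\Delta_E=\bar\Delta-2\overset{\circ}{R}$. A TT-tensor is a divergence-free, traceless smooth symmetric covariant 2-tensor field. On an Einstein manifold, $\Delta_E$ maps the space of TT-tensors to itself. $(M,g)$ is called unstable if $\Delta_E$ admits negative eigenvalues on TT-tensors. An infinitesimal Einstein deformation is a TT-tensor $\varphi$ with $\Delta_E\varphi=0$. $K_{\min}$ is the minimum of $\sec(\sigma_x)$ over all points $x\in M$ and all 2-planes $\sigma_x\subset T_xM$. *)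

(* Defs.v *)
From HB Require Import structures.
From mathcomp Require Import all_boot all_order all_algebra.
From mathcomp Require Import all_classical all_reals all_analysis.
Set Implicit Arguments.
Unset Strict Implicit.
Unset Printing Implicit Defensive.
Import Order.TTheory GRing.Theory Num.Theory.
Import numFieldNormedType.Exports.
Local Open Scope classical_set_scope.
Local Open Scope ring_scope.

Section Calculus.
Context {R : realType} {n : nat}.
Implicit Types (f : 'rV[R]_n -> R) (U : set 'rV[R]_n) (x : 'rV[R]_n).

Definition partial (i : 'I_n) f : 'rV[R]_n -> R := fun x => 'D_(delta_mx ord0 i) f x.

Definition partials (s : seq 'I_n) f : 'rV[R]_n -> R := foldr partial f s.

(* C^infinity on U; only meant for open U, where the values of [f] outside U
   are irrelevant. *)
Definition smooth_on U f : Prop :=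
  forall (s : seq 'I_n) x, U x ->
    {for x, continuous (partials s f)} /\
    forall i, derivable (partials s f) x (delta_mx ord0 i).

(* Row i, column k holds the i-th partial derivative of the k-th component. *)
Definition jacobian_mx (F : 'rV[R]_n -> 'rV[R]_n) x : 'M[R]_n :=
  \matrix_(i, k) partial i (fun y => F y ord0 k) x.

End Calculus.

(* All charts take values in open subsets of R^n, so there is no boundary.
   Hausdorffness and compactness of M are left to the users of this structure;
   a compact space with such an atlas is automatically second countable. *)
Record smooth_atlas (R : realType) (n : nat) (M : topologicalType) := SmoothAtlas {
  chart_index : Type;
  dom : chart_index -> set M;
  chart : chart_index -> M -> 'rV[R]_n;
  chart_inv : chart_index -> 'rV[R]_n -> M;
  dom_open : forall a, open (dom a);
  cod_open : forall a, open (chart a @` dom a);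
  dom_cover : forall p, exists a, dom a p;
  chartK : forall a p, dom a p -> chart_inv a (chart a p) = p;
  chart_continuous : forall a p, dom a p -> {for p, continuous (chart a)};
  chart_inv_continuous : forall a p, dom a p ->
    {for chart a p, continuous (chart_inv a)};
  transition_smooth : forall a b (k : 'I_n),
    smooth_on (chart a @` (dom a `&` dom b))
      (fun x => chart b (chart_inv a x) ord0 k) }.

Section Tensors.
Context {R : realType} {n : nat} {M : topologicalType} (A : smooth_atlas R n M).

Definition cod (a : chart_index A) : set 'rV[R]_n := chart a @` dom a.

Definition transition (a b : chart_index A) (x : 'rV[R]_n) : 'rV[R]_n :=
  chart b (chart_inv a x).

(* A smooth symmetric covariant 2-tensor field, given by its component matrices
   in the charts; [stensor a x] is meaningful only for x in [cod a], and the
   last field is the transformation law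
   T^a_ij = (d y^k / d x^i) (d y^l / d x^j) T^b_kl. *)
Record sym_tensor := SymTensor {
  stensor :> chart_index A -> 'rV[R]_n -> 'M[R]_n;
  stensor_smooth : forall a i j, smooth_on (cod a) (fun x => stensor a x i j);
  stensor_sym : forall a x, cod a x -> (stensor a x)^T = stensor a x;
  stensor_transform : forall a b p, dom a p -> dom b p ->
    let J := jacobian_mx (transition a b) (chart a p) in
    stensor a (chart a p) = J *m stensor b (chart b p) *m J^T }.

Record riemannian_metric := RiemannianMetric {
  metric_tensor :> sym_tensor;
  metric_posdef : forall a x (v : 'rV[R]_n), cod a x -> v != 0 ->
    0 < (v *m metric_tensor a x *m v^T) ord0 ord0 }.

Definition nonzero_tensor (phi : sym_tensor) : Prop :=
  exists a x, cod a x /\ phi a x != 0.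

End Tensors.

(* Tensor calculus in one chart: [g] and [phi] are component matrices of the
   metric and of a covariant 2-tensor as functions of the coordinates. *)
Section LocalGeometry.
Context {R : realType} {n : nat}.
Local Notation E := 'rV[R]_n.
Variable g : E -> 'M[R]_n.
Implicit Types (phi : E -> 'M[R]_n) (i j k l m : 'I_n) (x u v : E).

(* Levi-Civita connection: Gamma^k_ij *)
Definition christoffel k i j : E -> R := fun x =>
  2^-1 * \sum_l invmx (g x) k l *
    (partial i (fun y => g y j l) x + partial j (fun y => g y i l) x
     - partial l (fun y => g y i j) x).

(* R^i_kjl, where R(e_j, e_l) e_k = R^i_kjl e_i and
   R(X, Y) Z = nabla_X nabla_Y Z - nabla_Y nabla_X Z - nabla_[X,Y] Z *)
Definition curvature13 i k j l : E -> R := fun x =>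
  partial j (christoffel i l k) x - partial l (christoffel i j k) x
  + \sum_m (christoffel i j m x * christoffel m l k x
            - christoffel i l m x * christoffel m j k x).

(* R_ijkl *)
Definition curvature04 i j k l : E -> R := fun x =>
  \sum_m g x i m * curvature13 m j k l x.

Definition ricci k l : E -> R := fun x => \sum_i curvature13 i k i l x.

Definition scalar_curvature : E -> R := fun x =>
  \sum_k \sum_l invmx (g x) k l * ricci k l x.

Definition inner x u v : R := (u *m g x *m v^T) ord0 ord0.

Definition orthonormal_pair x u v : Prop :=
  [/\ inner x u u = 1, inner x v v = 1 & inner x u v = 0].

(* sec(u /\ v), for (u, v) an orthonormal basis of the 2-plane *)
Definition sec x u v : R :=
  \sum_i \sum_j \sum_k \sum_l
    curvature04 i j k l x * u ord0 i * v ord0 j * u ord0 k * v ord0 l.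

(* nabla_k phi_ij *)
Definition cov_deriv2 phi k i j : E -> R := fun x =>
  partial k (fun y => phi y i j) x
  - \sum_l (christoffel l k i x * phi x l j + christoffel l k j x * phi x i l).

(* nabla_m T_kij *)
Definition cov_deriv3 (T : 'I_n -> 'I_n -> 'I_n -> E -> R) m k i j : E -> R :=
  fun x => partial m (T k i j) x
  - \sum_l (christoffel l m k x * T l i j x + christoffel l m i x * T k l j x
            + christoffel l m j x * T k i l x).

Definition rough_laplacian phi i j : E -> R := fun x =>
  - \sum_m \sum_k invmx (g x) m k * cov_deriv3 (cov_deriv2 phi) m k i j x.

(* phi^kl *)
Definition raise2 phi k l : E -> R := fun x =>
  \sum_i \sum_j invmx (g x) k i * invmx (g x) l j * phi x i j.

Definition curvature_operator2 phi i j : E -> R := fun x =>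
  \sum_k \sum_l curvature04 i k j l x * raise2 phi k l x.

Definition einstein_operator phi i j : E -> R := fun x =>
  rough_laplacian phi i j x - 2 * curvature_operator2 phi i j x.

Definition trace2 phi : E -> R := fun x =>
  \sum_i \sum_j invmx (g x) i j * phi x i j.

(* - nabla^i phi_ij *)
Definition divergence phi j : E -> R := fun x =>
  - \sum_i \sum_k invmx (g x) i k * cov_deriv2 phi k i j x.

End LocalGeometry.

Section EinsteinStability.
Context {R : realType} {n : nat} {M : topologicalType} {A : smooth_atlas R n M}.
Variable g : riemannian_metric A.

Definition is_einstein : Prop :=
  exists kappa : R, forall a x, cod a x ->
    forall i j, ricci (g a) i j x = kappa * g a x i j.

Definition has_scalar_curvature (s : R) : Prop :=
  forall a x, cod a x -> scalar_curvature (g a) x = s.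

Definition sectional_curvatures : set R :=
  [set K | exists a x u v,
    [/\ cod a x, orthonormal_pair (g a) x u v & K = sec (g a) x u v]].

Definition is_min_sectional_curvature (K : R) : Prop :=
  sectional_curvatures K /\ lbound sectional_curvatures K.

Definition is_TT (phi : sym_tensor A) : Prop :=
  forall a x, cod a x ->
    (forall j, divergence (g a) (phi a) j x = 0) /\ trace2 (g a) (phi a) x = 0.

Definition is_TT_eigenvalue (lambda : R) : Prop :=
  exists phi : sym_tensor A,
    [/\ is_TT phi, nonzero_tensor phi &
        forall a x, cod a x -> forall i j,
          einstein_operator (g a) (phi a) i j x = lambda * phi a x i j].

Definition unstable : Prop :=
  exists2 lambda : R, lambda < 0 & is_TT_eigenvalue lambda.

Definition infinitesimal_einstein_deformation (phi : sym_tensor A) : Prop :=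
  is_TT phi /\
  forall a x, cod a x -> forall i j, einstein_operator (g a) (phi a) i j x = 0.

End EinsteinStability.

(* Main.v *)
Require Import Defs.
From HB Require Import structures.
From mathcomp Require Import all_boot all_order all_algebra.
From mathcomp Require Import all_classical all_reals all_analysis.
From mathcomp Require Import perm ring lra.
Set Implicit Arguments.
Unset Strict Implicit.
Unset Printing Implicit Defensive.
Import Order.TTheory GRing.Theory Num.Theory.
Import numFieldNormedType.Exports.
Local Open Scope classical_set_scope.
Local Open Scope ring_scope.

(** The proof replaces the usual integration by parts with the strong maximum
    principle.  Write [kappa = s / n], so that Ric = [kappa] g, and let [phi]
    be a TT-tensor with [Delta_E phi = lambda phi] and [lambda <= 0]; the
    claim in both cases is that [phi = 0] ([eigentensor_vanishes]).

    The sign of [s].  In an orthonormal frame a Ricci curvature is a sum of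
    [n - 1] sectional curvatures, so [kappa >= (n - 1) Kmin]
    ([einstein_constant_ge]), whereas the hypothesis reads
    [kappa <= n Kmin].  Together they give [kappa >= 0], and [kappa] is not zero
    because [s] is not.

    Pointwise estimate.  Let [R phi] denote the curvature operator of the second
    kind applied to [phi].  Diagonalise [phi] in an orthonormal frame, with
    eigenvalues [d_a] of sum zero.  Then <R phi, phi> is the sum over [a, b] of
    [K(a,b) d_a d_b], where [K(a,b)] are sectional curvatures with row sums
    [kappa]; comparing [K(a,b)] with [Kmin] gives
    <R phi, phi> <= [(kappa - n Kmin) |phi|^2 <= 0] ([curvature_pairing_le]).

    Bochner formula.  With [F = |phi|^2] and [L] the Laplace-Beltrami operator
    written as an elliptic operator in a chart,
    [L F = 2 |nabla phi|^2 - 4 <R phi, phi> - 2 lambda F] ([bochner]), a sum of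
    three nonnegative terms, so [F] is subharmonic.

    Conclusion.  The function [F] does not depend on the chart, so it attains
    its maximum on the compact manifold at some point, and by
    [strong_maximum_principle] it is constant near that point.  There [L F = 0],
    hence [nabla phi = 0]; commuting second derivatives of a parallel field
    gives [R phi = kappa phi] ([parallel_curvature_operator]), so that
    [kappa F] = <R phi, phi> [<= 0] and the maximum of [F] is zero
    ([constant_norm_vanishes]).  Therefore [phi] vanishes identically. *)

(** * Simultaneous diagonalisation of two quadratic forms *)

Section MatrixForms.
Context {R : realType}.

Lemma mulmx3E m n p q (B : 'M[R]_(m, n)) (A : 'M[R]_(n, p)) (C : 'M[R]_(p, q)) i j :
  (B *m A *m C) i j = \sum_k \sum_l B i k * A k l * C l j.
Proof.
rewrite mxE exchange_big /=; apply: eq_bigr => l _.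
by rewrite mxE mulr_suml.
Qed.

Lemma continuous_sumr (I : Type) (T : topologicalType) (r : seq I)
    (f : I -> T -> R) (x : T) :
  (forall i, {for x, continuous (f i)}) ->
  {for x, continuous (fun y => \sum_(i <- r) f i y)}.
Proof.
move=> fc; apply: cvg_big => //; first exact: add_continuous.
by move=> i _; exact: fc.
Qed.

Lemma continuous_quadratic n (A : 'M[R]_n) :
  continuous (fun x : 'rV[R]_n => (x *m A *m x^T) ord0 ord0).
Proof.
move=> x; rewrite (_ : (fun x => _) = (fun x : 'rV[R]_n =>
   \sum_i \sum_j x ord0 i * A i j * x ord0 j)); last first.
  apply/funext => y; rewrite mulmx3E; apply: eq_bigr => i _.
  by apply: eq_bigr => j _; rewrite mxE.
apply: continuous_sumr => i; apply: continuous_sumr => j.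
apply: (@continuousM _ _ (fun y : 'rV[R]_n => y ord0 i * A i j)
  (fun y : 'rV[R]_n => y ord0 j)); last exact: coord_continuous.
apply: (@continuousM _ _ (fun y : 'rV[R]_n => y ord0 i) (cst (A i j))).
  exact: coord_continuous.
exact: cst_continuous.
Qed.

Lemma quadraticZ n (A : 'M[R]_n) (t : R) (x : 'rV[R]_n) :
  ((t *: x) *m A *m (t *: x)^T) ord0 ord0
  = t ^+ 2 * (x *m A *m x^T) ord0 ord0.
Proof.
by rewrite linearZ /= -scalemxAr -!scalemxAl scalerA !mxE expr2.
Qed.

Definition posdefmx n (g : 'M[R]_n) :=
  forall v : 'rV[R]_n, v != 0 -> 0 < (v *m g *m v^T) ord0 ord0.

(** By compactness of the unit sphere the quotient [phi(v, v) / g(v, v)] has a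
    maximum [mu]; in homogeneous form this says that [phi - mu g] is negative
    semidefinite and isotropic at the maximiser. *)
Lemma rayleigh_max n (g phi : 'M[R]_n.+1) : posdefmx g ->
  exists v : 'rV[R]_n.+1, exists mu : R, v != 0 /\
    (v *m (phi - mu *: g) *m v^T) ord0 ord0 = 0 /\
    forall x : 'rV[R]_n.+1, (x *m (phi - mu *: g) *m x^T) ord0 ord0 <= 0.
Proof.
move=> gpos.
pose q A (x : 'rV[R]_n.+1) : R := (x *m A *m x^T) ord0 ord0.
have qB mu x : q (phi - mu *: g) x = q phi x - mu * q g x.
  by rewrite /q mulmxBr mulmxBl -scalemxAr -scalemxAl !mxE.
pose S := [set x : 'rV[R]_n.+1 | `|x| = 1].
have S_neq0 x : S x -> x != 0.
  by move=> Sx; rewrite -normr_gt0 Sx.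
have unitS (x : 'rV[R]_n.+1) : x != 0 -> S (`|x|^-1 *: x).
  move=> x0; rewrite /S /= normrZ normfV normr_id mulVf //.
  by rewrite normr_eq0.
have S0 : S !=set0.
  exists (`|delta_mx ord0 ord0 : 'rV[R]_n.+1|^-1 *: delta_mx ord0 ord0).
  by apply: unitS; apply/eqP => /matrixP/(_ ord0 ord0)/eqP; rewrite !mxE oner_eq0.
have cS : compact S.
  apply: bounded_closed_compact.
    by exists 1; split => // M M1 x /= ->; exact: ltW.
  apply: (@closed_comp _ _ (fun x : 'rV[R]_n.+1 => `|x|) [set 1]).
    by move=> x _; exact: norm_continuous.
  exact: closed_eq.
have qc : {within S, continuous (fun x => q phi x / q g x)}.
  apply: continuous_in_subspaceT => x /set_mem Sx.
  apply: (@continuousM _ _ (q phi) (fun x => (q g x)^-1)).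
    exact: continuous_quadratic.
  apply: continuousV; last exact: continuous_quadratic.
  by rewrite gt_eqF // gpos // S_neq0.
have [v vS vmax] := EVT_max_rV S0 cS qc.
have v0 : v != 0 by apply: S_neq0; apply: set_mem.
exists v, (q phi v / q g v); split => //; split.
  by rewrite -/(q _ _) qB divfK ?subrr // gt_eqF // gpos.
move=> x; rewrite -/(q _ _).
have [->|x0] := eqVneq x 0; first by rewrite /q !mul0mx mxE.
have xx : x = `|x| *: (`|x|^-1 *: x).
  by rewrite scalerA divff ?scale1r // normr_eq0.
rewrite xx [q _ _]quadraticZ -/(q _ _) qB.
set y := _ *: x; have Sy : S y by exact: unitS.
apply: mulr_ge0_le0; first exact: sqr_ge0.
rewrite subr_le0 -ler_pdivrMr; last by apply: gpos; exact: S_neq0.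
by apply: vmax; exact: mem_set.
Qed.

(** An isotropic vector of a semidefinite form lies in its radical: otherwise
    the form would change sign along a line through that vector. *)
Lemma semidef_isotropic n (D : 'M[R]_n) (v : 'rV[R]_n) : D^T = D ->
  (forall x : 'rV[R]_n, (x *m D *m x^T) ord0 ord0 <= 0) ->
  (v *m D *m v^T) ord0 ord0 = 0 -> v *m D = 0.
Proof.
move=> Dsym Dle vD0.
suff H (w : 'rV[R]_n) : (v *m D *m w^T) ord0 ord0 = 0.
  apply/rowP => j; rewrite [RHS]mxE -(H (delta_mx ord0 j)).
  by rewrite trmx_delta -colE [RHS]mxE.
pose b := (v *m D *m w^T) ord0 ord0; pose c := (w *m D *m w^T) ord0 ord0.
have wv : (w *m D *m v^T) ord0 ord0 = b.
  have -> : w *m D *m v^T = (v *m D *m w^T)^T.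
    by rewrite !trmx_mul trmxK Dsym mulmxA.
  by rewrite mxE.
have H t : t * b *+ 2 + t ^+ 2 * c <= 0.
  have := Dle (v + t *: w).
  suff -> : ((v + t *: w) *m D *m (v + t *: w)^T) ord0 ord0
    = t * b *+ 2 + t ^+ 2 * c by [].
  have qDl (x y z : 'rV[R]_n) : ((x + y) *m D *m z^T) ord0 ord0
     = (x *m D *m z^T) ord0 ord0 + (y *m D *m z^T) ord0 ord0.
    by rewrite !mulmxDl mxE.
  have qDr (x y z : 'rV[R]_n) : (z *m D *m (x + y)^T) ord0 ord0
     = (z *m D *m x^T) ord0 ord0 + (z *m D *m y^T) ord0 ord0.
    by rewrite linearD mulmxDr mxE.
  have qZl (x z : 'rV[R]_n) :
    ((t *: x) *m D *m z^T) ord0 ord0 = t * (x *m D *m z^T) ord0 ord0.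
    by rewrite -!scalemxAl mxE.
  have qZr (x z : 'rV[R]_n) :
    (z *m D *m (t *: x)^T) ord0 ord0 = t * (z *m D *m x^T) ord0 ord0.
    by rewrite linearZ -scalemxAr mxE.
  by rewrite qDl !qDr !qZl !qZr vD0 wv -/b -/c; ring.
suff : b = 0 by [].
have k0 : 0 < `|c| + 1 by rewrite ltr_wpDl.
apply/eqP; rewrite -sqrf_eq0 eq_le sqr_ge0 andbT.
(* With this step the linear term of [H] dominates the quadratic one. *)
have := H (b / (`|c| + 1)).
have -> : b / (`|c| + 1) * b *+ 2 + (b / (`|c| + 1)) ^+ 2 * c
  = (b ^+ 2) * ((`|c| + 1) *+ 2 + c) / (`|c| + 1) ^+ 2.
  by field; rewrite gt_eqF.
rewrite pmulr_lle0; last by rewrite invr_gt0 exprn_gt0.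
rewrite pmulr_lle0 //.
by have := ler_norm (- c); rewrite normrN; have := normr_ge0 c; lra.
Qed.

Lemma orthogonal_hyperplane n (c : 'cV[R]_n.+1) : c != 0 ->
  exists2 W : 'M[R]_(n, n.+1), row_free W & W *m c = 0.
Proof.
move=> c0; have rk : \rank (kermx c) = n.
  by rewrite mxrank_ker -mxrank_tr rank_rV trmx_eq0 c0 subn1.
have /sub_kermxP W0 : (row_base (kermx c) <= kermx c)%MS by rewrite eq_row_base.
move: (row_base (kermx c)) W0 (row_base_free (kermx c)); rewrite rk => W W0 Wf.
by exists W.
Qed.

(** Deflation: a maximiser [v] of the Rayleigh quotient is an eigenvector of
    [phi] relative to [g], and on the [g]-orthogonal of [v] the induction
    hypothesis applies to the two restricted forms.  The rows of [B] are the
    resulting [g]-orthonormal frame. *)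
Lemma simultaneous_diagonalization n (g phi : 'M[R]_n) :
  g^T = g -> posdefmx g -> phi^T = phi ->
  exists B : 'M[R]_n, exists d : 'rV[R]_n,
    B *m g *m B^T = 1%:M /\ B *m phi *m B^T = diag_mx d.
Proof.
elim: n g phi => [|n IHn] g phi gsym gpos phisym.
  by exists 0, 0; split; apply/matrixP => -[].
have [v [mu [v0 [vmu mumax]]]] := rayleigh_max phi gpos.
have /semidef_isotropic /(_ mumax vmu) eig : (phi - mu *: g)^T = phi - mu *: g.
  by rewrite linearB /= linearZ /= gsym phisym.
have {eig} vphi : v *m phi = mu *: (v *m g).
  by apply/eqP; rewrite -subr_eq0 scalemxAr -mulmxBr eig.
have gv0 : g *m v^T != 0.
  by apply: contraTneq (gpos v v0) => E; rewrite -mulmxA E mulmx0 mxE ltxx.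
have [W Wfree Wgv] := orthogonal_hyperplane gv0.
pose N : R := (v *m g *m v^T) ord0 ord0; have N0 : 0 < N by exact: gpos.
have vgv : v *m g *m v^T = N%:M by exact: mx11_scalar.
have [| | |B [d [Bg Bphi]]] := IHn (W *m g *m W^T) (W *m phi *m W^T).
- by rewrite !trmx_mul trmxK gsym mulmxA.
- move=> w w0; rewrite -!mulmxA -trmx_mul !mulmxA; apply: gpos.
  by rewrite -(mul0mx _ W) (inj_eq (row_free_inj Wfree)).
- by rewrite !trmx_mul trmxK phisym mulmxA.
pose a := (Num.sqrt N)^-1; have aN : a * (a * N) = 1.
  by rewrite mulrA -invfM -expr2 sqr_sqrtr ?ltW // mulVf // gt_eqF.
have vgW : v *m g *m W^T = 0.
  by apply: trmx_inj; rewrite !trmx_mul trmxK gsym trmx0.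
have Wphiv : W *m phi *m v^T = 0.
  apply: trmx_inj; rewrite !trmx_mul trmxK phisym trmx0 mulmxA vphi.
  by rewrite -scalemxAl vgW scaler0.
pose C : 'M[R]_(1 + n, n.+1) := col_mx (a *: v) (B *m W).
have vphiW : v *m phi *m W^T = 0 by rewrite vphi -scalemxAl vgW scaler0.
have Wgv' : W *m g *m v^T = 0 by rewrite -mulmxA.
(* [C] is block diagonalising: its first row is [v] normalised, the others lie
   in the [g]-orthogonal of [v], spanned by the rows of [W]. *)
have conjC (A : 'M[R]_n.+1) (p : R) : v *m A *m v^T = (p * N)%:M ->
    v *m A *m W^T = 0 -> W *m A *m v^T = 0 ->
    C *m A *m C^T = block_mx p%:M 0 0 (B *m (W *m A *m W^T) *m B^T).
  move=> vAv vAW WAv; rewrite /C tr_col_mx mul_col_mx mul_col_row.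
  rewrite linearZ /= trmx_mul -!scalemxAl -!scalemxAr vAv.
  rewrite !mulmxA vAW mul0mx scaler0 -[B *m W *m A]mulmxA -[B *m _ *m v^T]mulmxA WAv.
  rewrite mulmx0 scaler0 !mulmxA; congr block_mx.
  by rewrite !scale_scalar_mx [p * N]mulrC mulrA mulrA -[a * a * N]mulrA aN mul1r.
exists C, (row_mx (mu%:M) d : 'rV[R]_(1 + n)); split.
  rewrite (@conjC _ 1) // ?mul1r // Bg.
  by rewrite -(@scalar_mx_block R 1 n).
rewrite (@conjC _ mu) // ?Bphi; last by rewrite vphi -scalemxAl vgv scale_scalar_mx.
rewrite (@diag_mx_row _ n 1) (_ : diag_mx mu%:M = mu%:M) //.
by apply/matrixP => i j; rewrite !ord1 !mxE.
Qed.

End MatrixForms.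

(** * Algebraic curvature tensors at a point *)

Section PointwiseCurvature.
Context {R : realType} {n : nat}.
Implicit Types (B M : 'M[R]_n) (d u v : 'rV[R]_n).

(** The pairing of a bilinear form [M] with the symmetric tensor that has
    eigenvalues [d] in the frame [B] is the [d]-weighted sum of the diagonal
    values of [M] in that frame. *)
Lemma sum_conj_diag B d M :
  \sum_k \sum_l M k l * (B^T *m diag_mx d *m B) k l
  = \sum_a d ord0 a * \sum_k \sum_l M k l * B a k * B a l.
Proof.
have E k l : (B^T *m diag_mx d *m B) k l = \sum_a d ord0 a * B a k * B a l.
  rewrite mul_mx_diag mxE; apply: eq_bigr => a _; rewrite !mxE; ring.
under eq_bigr => k _ do under eq_bigr => l _ do rewrite E mulr_sumr.
under eq_bigr => k _ do rewrite exchange_big.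
rewrite exchange_big; apply: eq_bigr => a _; rewrite mulr_sumr.
apply: eq_bigr => k _; rewrite mulr_sumr; apply: eq_bigr => l _; ring.
Qed.

Lemma sum_gram B M :
  \sum_k \sum_l M k l * (B^T *m B) k l
  = \sum_a \sum_k \sum_l M k l * B a k * B a l.
Proof.
have := sum_conj_diag B (const_mx 1) M.
rewrite diag_const_mx mulmx1 => ->; apply: eq_bigr => a _.
by rewrite mxE mul1r.
Qed.

Variable Rm : 'I_n -> 'I_n -> 'I_n -> 'I_n -> R.

(** The bilinear form [v, w |-> R(u, v, u, w)], polar to the sectional
    curvature in its second vector. *)
Definition jacobi_form u : 'M[R]_n :=
  \matrix_(j, l) \sum_i \sum_k Rm i j k l * u ord0 i * u ord0 k.

Definition sec_form u v : R :=
  \sum_i \sum_j \sum_k \sum_l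
    Rm i j k l * u ord0 i * v ord0 j * u ord0 k * v ord0 l.

Lemma sec_form_jacobi u v :
  sec_form u v = \sum_j \sum_l jacobi_form u j l * v ord0 j * v ord0 l.
Proof.
rewrite /sec_form exchange_big; apply: eq_bigr => j _.
under eq_bigr => i _ do rewrite exchange_big.
rewrite exchange_big; apply: eq_bigr => l _; rewrite mxE.
rewrite !mulr_suml; apply: eq_bigr => i _; rewrite !mulr_suml.
apply: eq_bigr => k _; ring.
Qed.

(** Applying [sum_conj_diag] in both pairs of slots turns <R P, P> into a
    quadratic form in the eigenvalues, with sectional curvatures as
    coefficients. *)
Lemma curvature_pairing_diag B d (P := B^T *m diag_mx d *m B) :
  \sum_i \sum_j (\sum_k \sum_l Rm i k j l * P k l) * P i j
  = \sum_a \sum_b d ord0 a * d ord0 b * sec_form (row a B) (row b B).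
Proof.
pose M k l := \matrix_(i, j) Rm i k j l.
transitivity (\sum_k \sum_l (\sum_i \sum_j M k l i j * P i j) * P k l).
  under eq_bigr => i _ do under eq_bigr => j _ do rewrite mulr_suml.
  under eq_bigr => i _ do rewrite exchange_big.
  rewrite exchange_big; apply: eq_bigr => k _.
  under eq_bigr => i _ do under eq_bigr => j _ do rewrite mulr_suml.
  under eq_bigr => i _ do rewrite exchange_big.
  rewrite exchange_big; apply: eq_bigr => l _.
  rewrite mulr_suml; apply: eq_bigr => i _; rewrite mulr_suml.
  by apply: eq_bigr => j _; rewrite [M _ _ _ _]mxE; ring.
have E k l : \sum_i \sum_j M k l i j * P i j =
    \sum_a d ord0 a * jacobi_form (row a B) k l.
  rewrite sum_conj_diag; apply: eq_bigr => a _; rewrite mxE.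
  congr (_ * _); apply: eq_bigr => i _; apply: eq_bigr => j _.
  by rewrite !mxE.
under eq_bigr => k _ do under eq_bigr => l _ do rewrite E mulr_suml.
under eq_bigr => k _ do rewrite exchange_big.
rewrite exchange_big; apply: eq_bigr => a _.
transitivity (d ord0 a * \sum_k \sum_l jacobi_form (row a B) k l * P k l).
  rewrite mulr_sumr; apply: eq_bigr => k _; rewrite mulr_sumr.
  by apply: eq_bigr => l _; rewrite mulrA.
rewrite sum_conj_diag mulr_sumr; apply: eq_bigr => b _.
rewrite mulrA sec_form_jacobi; congr (_ * _).
by apply: eq_bigr => k _; apply: eq_bigr => l _; rewrite !mxE.
Qed.

Variables (g : 'M[R]_n) (kappa : R).
Hypothesis anti12 : forall i j k l, Rm i j k l = - Rm j i k l.
Hypothesis anti34 : forall i j k l, Rm i j k l = - Rm i j l k.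
Hypothesis gsym : g^T = g.
Hypothesis einstein : forall k l,
  \sum_i \sum_q invmx g i q * Rm q k i l = kappa * g k l.

Lemma sec_formC u v : sec_form u v = sec_form v u.
Proof.
rewrite /sec_form exchange_big; apply: eq_bigr => j _; apply: eq_bigr => i _.
rewrite exchange_big; apply: eq_bigr => l _; apply: eq_bigr => k _.
by rewrite anti12 anti34; ring.
Qed.

Lemma sec_form_diag u : sec_form u u = 0.
Proof.
suff : sec_form u u = - sec_form u u by lra.
rewrite {2}/sec_form exchange_big -sumrN; apply: eq_bigr => j _.
rewrite -sumrN; apply: eq_bigr => i _.
rewrite -sumrN; apply: eq_bigr => k _.
rewrite -sumrN; apply: eq_bigr => l _.
by rewrite anti12; ring.
Qed.

Lemma frame_invmx B : B *m g *m B^T = 1%:M ->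
  [/\ g \in unitmx, B \in unitmx & invmx g = B^T *m B].
Proof.
move=> BgB; have [BgU BTU] := mulmx1_unit BgB.
have BU : B \in unitmx by rewrite -unitmx_tr.
have gU : g \in unitmx by move: BgU; rewrite unitmx_mul => /andP[].
split=> //; apply: (can_inj (mulKmx gU)); rewrite mulmxV //.
apply: (can_inj (mulKmx BU)); rewrite mulmx1 !mulmxA.
by rewrite BgB mul1mx.
Qed.

Lemma frame_inner B : B *m g *m B^T = 1%:M -> forall a b,
  (row a B *m g *m (row b B)^T) ord0 ord0 = (a == b)%:R.
Proof.
move=> BgB a b; have /matrixP/(_ a b) := BgB; rewrite [RHS]mxE => <-.
rewrite !mulmx3E; apply: eq_bigr => k _; apply: eq_bigr => l _.
by rewrite !mxE.
Qed.

(** Tracing the curvature over an orthonormal frame in its first and third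
    slots gives the Ricci form, which is [kappa g] here; a frame vector has unit
    length. *)
Lemma frame_ricci B b : B *m g *m B^T = 1%:M ->
  \sum_a sec_form (row a B) (row b B) = kappa.
Proof.
move=> BgB; have [_ _ hB] := frame_invmx BgB.
transitivity (\sum_j \sum_l (\sum_a jacobi_form (row a B) j l) * B b j * B b l).
  rewrite (eq_bigr _ (fun a _ => sec_form_jacobi _ _)) exchange_big.
  apply: eq_bigr => j _; rewrite exchange_big; apply: eq_bigr => l _.
  by rewrite !mulr_suml; apply: eq_bigr => a _; rewrite !mxE.
have E j l : \sum_a jacobi_form (row a B) j l = kappa * g j l.
  rewrite -einstein.
  have := sum_gram B (\matrix_(i, k) Rm k j i l).
  rewrite -hB => G.
  transitivity (\sum_k \sum_i (\matrix_(i, k) Rm k j i l) k i * invmx g k i).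
    rewrite G; apply: eq_bigr => a _; rewrite mxE exchange_big.
    by apply: eq_bigr => i _; apply: eq_bigr => k _; rewrite !mxE; ring.
  by apply: eq_bigr => k _; apply: eq_bigr => i _; rewrite mxE mulrC.
under eq_bigr => j _ do under eq_bigr => l _ do rewrite E.
transitivity (kappa * (row b B *m g *m (row b B)^T) ord0 ord0); last first.
  by rewrite frame_inner // eqxx mulr1.
rewrite mulmx3E mulr_sumr; apply: eq_bigr => j _.
rewrite mulr_sumr; apply: eq_bigr => l _; rewrite !mxE; ring.
Qed.

Variable Kmin : R.
Hypothesis KminP : forall u v,
  (u *m g *m u^T) ord0 ord0 = 1 -> (v *m g *m v^T) ord0 ord0 = 1 ->
  (u *m g *m v^T) ord0 ord0 = 0 -> Kmin <= sec_form u v.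

Lemma frame_sec_ge B a b : B *m g *m B^T = 1%:M -> a != b ->
  Kmin <= sec_form (row a B) (row b B).
Proof.
move=> BgB ab; apply: KminP; rewrite frame_inner //; try by rewrite eqxx.
by rewrite (negbTE ab).
Qed.

(** A Ricci curvature is the sum of the [n - 1] sectional curvatures of the
    planes spanned by a frame vector and the other ones. *)
Lemma einstein_constant_ge : (0 < n)%N -> posdefmx g ->
  n.-1%:R * Kmin <= kappa.
Proof.
move=> n0 gpos; have [B [_ [BgB _]]] :=
  simultaneous_diagonalization gsym gpos (trmx1 _ _).
pose b := Ordinal n0; rewrite -(frame_ricci b BgB).
rewrite (bigD1 b) //= sec_form_diag add0r.
apply: (@le_trans _ _ (\sum_(i | i != b) Kmin)).
  by rewrite sumr_const cardC1 card_ord mulr_natl.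
by apply: ler_sum => a ab; apply: frame_sec_ge.
Qed.

(** In a frame that diagonalises [phi], write the sectional curvatures as
    [K a b = Kmin + L a b] off the diagonal, with [L a b >= 0].  The [L]-part is
    bounded by [2 x y <= x^2 + y^2] and the row sums [kappa] of [K]; the
    [Kmin]-part is computed from the vanishing of the trace. *)
Lemma curvature_pairing_le (phi : 'M[R]_n) (P := invmx g *m phi *m invmx g) :
  posdefmx g -> phi^T = phi -> \tr (invmx g *m phi) = 0 ->
  \sum_i \sum_j (\sum_k \sum_l Rm i k j l * P k l) * P i j
    <= (kappa - n%:R * Kmin) * \tr (invmx g *m phi *m (invmx g *m phi)).
Proof.
move=> gpos phisym tr0.
have [B [d [BgB Bphi]]] := simultaneous_diagonalization gsym gpos phisym.
have [gU BU hB] := frame_invmx BgB.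
have PE : P = B^T *m diag_mx d *m B by rewrite /P hB -Bphi !mulmxA.
have trd : \sum_a d ord0 a = 0.
  rewrite -mxtrace_diag -Bphi -mulmxA mxtrace_mulC -mulmxA -[RHS]tr0 hB.
  by rewrite mxtrace_mulC.
have trd2 : \tr (invmx g *m phi *m (invmx g *m phi)) = \sum_a d ord0 a ^+ 2.
  transitivity (\tr (B *m phi *m B^T *m (B *m phi *m B^T))).
    by rewrite hB -!mulmxA mxtrace_mulC !mulmxA.
  by rewrite Bphi mulmx_diag mxtrace_diag; apply: eq_bigr => a _; rewrite mxE.
rewrite PE curvature_pairing_diag trd2.
pose K a b := sec_form (row a B) (row b B).
have Ksum b : \sum_a K a b = kappa by exact: frame_ricci.
have Ksum' a : \sum_b K a b = kappa.
  by rewrite -(Ksum a); apply: eq_bigr => b _; exact: sec_formC.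
(* Off the diagonal this is [0 <= (K a b - Kmin) (d a - d b)^2]; on it both sides
   vanish.  The form is chosen so that each term can be summed separately. *)
have key a b : d ord0 a * d ord0 b * K a b <=
  (d ord0 a ^+ 2 * K a b + d ord0 b ^+ 2 * K a b) / 2
  + Kmin * (d ord0 a * d ord0 b) - Kmin * (d ord0 a ^+ 2 + d ord0 b ^+ 2) / 2.
  have [->|ab] := eqVneq a b.
    by rewrite /K sec_form_diag; lra.
  have L0 : 0 <= K a b - Kmin by rewrite subr_ge0; exact: frame_sec_ge.
  have := mulr_ge0 L0 (sqr_ge0 (d ord0 a - d ord0 b)); nra.
apply: (le_trans (ler_sum _ (fun a _ => ler_sum _ (fun b _ => key a b)))).
rewrite le_eqVlt; apply/orP; left; apply/eqP.
have S1 : \sum_a \sum_b d ord0 a ^+ 2 * K a b = kappa * \sum_a d ord0 a ^+ 2.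
  rewrite mulr_sumr; apply: eq_bigr => a _.
  by rewrite -mulr_sumr Ksum' mulrC.
have S2 : \sum_a \sum_b d ord0 b ^+ 2 * K a b = kappa * \sum_a d ord0 a ^+ 2.
  rewrite exchange_big mulr_sumr; apply: eq_bigr => a _.
  by rewrite -mulr_sumr Ksum mulrC.
have S3 : \sum_a \sum_b d ord0 a * d ord0 b = 0.
  by under eq_bigr => a _ do rewrite -mulr_sumr trd mulr0; rewrite big1.
have S4 : \sum_(a < n) \sum_(b < n) d ord0 a ^+ 2 = n%:R * \sum_a d ord0 a ^+ 2.
  rewrite mulr_sumr; apply: eq_bigr => a _.
  by rewrite sumr_const card_ord mulr_natl.
have S5 : \sum_(a < n) \sum_(b < n) d ord0 b ^+ 2 = n%:R * \sum_a d ord0 a ^+ 2.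
  by rewrite sumr_const card_ord mulr_natl.
transitivity ((\sum_a \sum_b d ord0 a ^+ 2 * K a b
    + \sum_a \sum_b d ord0 b ^+ 2 * K a b) / 2
  + Kmin * (\sum_a \sum_b d ord0 a * d ord0 b)
  - Kmin * (\sum_(a < n) \sum_(b < n) d ord0 a ^+ 2
    + \sum_(a < n) \sum_(b < n) d ord0 b ^+ 2) / 2).
  have lin (F1 F2 F3 F4 F5 : 'I_n -> R) : \sum_a ((F1 a + F2 a) / 2
     + Kmin * F3 a - Kmin * (F4 a + F5 a) / 2) =
    (\sum_a F1 a + \sum_a F2 a) / 2 + Kmin * (\sum_a F3 a)
     - Kmin * (\sum_a F4 a + \sum_a F5 a) / 2.
    rewrite big_split sumrN big_split -mulr_suml big_split -mulr_sumr.
    by rewrite -mulr_suml -mulr_sumr big_split.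
  by rewrite -lin; apply: eq_bigr => a _; rewrite -lin.
by rewrite S1 S2 S3 S4 S5; field.
Qed.

End PointwiseCurvature.

(** * Directional derivatives *)

Section DirectionalDerivatives.
Context {R : realType} {n : nat}.
Local Notation E := 'rV[R]_n.
Implicit Types (f : E -> R) (x y u v w : E) (t h : R).

Lemma line_is_derive f x v t : derivable f (t *: v + x) v ->
  is_derive t 1 (fun h => f (h *: v + x)) ('D_v f (t *: v + x)).
Proof.
move=> df; rewrite /derivable /derive in df *.
have H : (fun h : R => h^-1 *: (((fun h => f (h *: v + x)) \o shift t) (h *: 1) - f (t *: v + x)))
  = (fun h : R => h^-1 *: ((f \o shift (t *: v + x)) (h *: v) - f (t *: v + x))).
  by apply/funext => h /=; rewrite [h *: 1]mulr1 scalerDl addrA.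
by split; rewrite /derivable /derive H.
Qed.

(** The mean value theorem along a line, with a step [h] of either sign, so
    that it applies to the difference quotients of [derivable]. *)
Lemma line_mvt f x v h :
  (forall t, `|t| <= `|h| -> derivable f (t *: v + x) v) ->
  exists2 t, `|t| <= `|h| & f (h *: v + x) - f x = h * 'D_v f (t *: v + x).
Proof.
move=> df.
have dl t : `|t| <= `|h| ->
    is_derive t 1 (fun h => f (h *: v + x)) ('D_v f (t *: v + x)).
  by move=> /df; exact: line_is_derive.
have cl a b : (forall t, t \in `[a, b] -> `|t| <= `|h|) ->
    {within `[a, b], continuous (fun h => f (h *: v + x))}.
  move=> ab; apply: continuous_in_subspaceT => t /set_mem /= tab.
  have [+ _] := dl t (ab _ tab).
  by move=> /derivable1_diffP/differentiable_continuous.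
have [h0|h0] := leP 0 h.
  have ab t : t \in `[0, h] -> `|t| <= `|h|.
    by rewrite in_itv /= => /andP[t0 th]; rewrite !ger0_norm.
  have [t tab E] := MVT_segment h0
    (fun t tab => dl t (ab t (subset_itv_oo_cc tab))) (cl _ _ ab).
  exists t; first exact: ab.
  by move: E; rewrite scale0r add0r subr0 mulrC.
have ab t : t \in `[h, 0] -> `|t| <= `|h|.
  rewrite in_itv /= => /andP[th t0].
  by rewrite (ler0_norm t0) (ltr0_norm h0) lerN2.
have [t tab E] := MVT_segment (ltW h0)
  (fun t tab => dl t (ab t (subset_itv_oo_cc tab))) (cl _ _ ab).
exists t; first exact: ab.
by move: E; rewrite scale0r add0r sub0r mulrN mulrC => /eqP; rewrite -eqr_oppLR opprB => /eqP.
Qed.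

(** Additivity of the directional derivative in the direction.  The increment
    along [h (v + w)] is one along [h w] followed by one along [h v]; the mean
    value theorem evaluates the latter at a nearby point, where continuity of
    ['D_v f] brings it back to [x]. *)
Lemma is_derive_add f x v w : (\forall y \near x, derivable f y v) ->
  {for x, continuous ('D_v f)} -> derivable f x w ->
  is_derive x (v + w) f ('D_v f x + 'D_w f x).
Proof.
move=> dfv cfv dfw.
suff H : (fun h => h^-1 *: ((f \o shift x) (h *: (v + w)) - f x)) @ 0^' -->
    'D_v f x + 'D_w f x.
  split; first by apply/cvg_ex; exists ('D_v f x + 'D_w f x).
  exact: cvg_lim H.
pose g h := h^-1 * (f (h *: v + (h *: w + x)) - f (h *: w + x)).
have -> : (fun h => h^-1 *: ((f \o shift x) (h *: (v + w)) - f x)) =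
   (fun h => g h + h^-1 *: ((f \o shift x) (h *: w) - f x)).
  apply/funext => h; rewrite /g /= [h *: (v + w)]scalerDr -[h *: v + _ + x]addrA.
  by rewrite -[RHS]mulrDr; congr (_ * _); rewrite [RHS]addrA subrK.
apply: cvgD; last exact: dfw.
apply/cvgrPdist_le => e e0.
have /nbhs_normP[r /= r0 H] : \forall y \near x,
    derivable f y v /\ `|'D_v f x - 'D_v f y| <= e.
  apply: filterI; first exact: dfv.
  by move/cvgrPdist_le: cfv => /(_ _ e0).
near=> h.
have hr : `|h| * (`|v| + `|w| + 1) < r.
  rewrite -ltr_pdivlMr ?ltr_wpDl ?addr_ge0 //.
  near: h; apply: dnbhs0_lt; rewrite divr_gt0 // ltr_wpDl ?addr_ge0 //.
have inr t : `|t| <= `|h| -> `|x - (t *: v + (h *: w + x))| < r.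
  move=> th; apply: le_lt_trans hr; rewrite addrA opprD addrCA subrr addr0 normrN.
  apply: (le_trans (ler_normD _ _)); rewrite !normrZ !mulrDr mulr1.
  rewrite ler_wpDr // lerD2r; exact: ler_wpM2r.
have [|t th fE] := @line_mvt f (h *: w + x) v h.
  by move=> t /inr /H[].
rewrite /g fE mulKf; last by near: h; exact: nbhs_dnbhs_neq.
by have [] := H _ (inr _ th).
Unshelve. all: by end_near. Qed.

Lemma is_derive_line f x v (d : R) :
  is_derive (0 : R) 1 (fun h => f (h *: v + x)) d -> is_derive x v f d.
Proof.
have H : (fun h : R => h^-1 *: (((fun h => f (h *: v + x)) \o shift 0) (h *: 1)
      - f (0 *: v + x)))
  = (fun h : R => h^-1 *: ((f \o shift x) (h *: v) - f x)).
  by apply/funext => h /=; rewrite [h *: 1]mulr1 addr0 scale0r add0r.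
by case; rewrite /derivable /derive H => *; split.
Qed.

Lemma is_derive_scale f x v t : derivable f x v ->
  is_derive x (t *: v) f (t * 'D_v f x).
Proof.
move=> df; apply: is_derive_line.
have -> : (fun h => f (h *: (t *: v) + x)) =
    (fun h => f (h *: v + x)) \o (fun h => h * t).
  by apply/funext => h /=; rewrite scalerA.
have dt : is_derive (0 : R) 1 (fun h : R => h * t) t.
  have : is_derive (0 : R) 1 (t \*: (id : R -> R)) (t *: 1).
    by apply: is_deriveZ.
  have -> : t \*: (id : R -> R) = (fun h => h * t).
    by apply/funext => h /=; rewrite mulrC.
  by rewrite [t *: 1]mulr1.
have d0 : is_derive (0 * t) 1 (fun h => f (h *: v + x)) ('D_v f x).
  have := @line_is_derive f x v 0; rewrite !scale0r !add0r mul0r; exact.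
by rewrite mulrC; exact: is_derive1_comp.
Qed.

End DirectionalDerivatives.

(** * Symmetry of second derivatives and the second derivative test *)

Section SecondOrder.
Context {R : realType} {n : nat}.
Local Notation E := 'rV[R]_n.
Implicit Types (f : E -> R) (x y u v w : E) (t h : R).

Lemma is_derive_translate f x v a : derivable f (a + x) v ->
  is_derive x v (fun y => f (a + y)) ('D_v f (a + x)).
Proof.
have H : (fun h : R => h^-1 *: (((fun y => f (a + y)) \o shift x) (h *: v) - f (a + x)))
  = (fun h : R => h^-1 *: ((f \o shift (a + x)) (h *: v) - f (a + x))).
  by apply/funext => h /=; rewrite addrCA.
by move=> df; split; rewrite /derivable /derive H.
Qed.

(** The second-order difference of [f] over a small parallelogram is
    [s^2 'D_v ('D_u f) x] up to [o(s^2)], by two applications of the mean value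
    theorem.  Both the symmetry of second derivatives and the second derivative
    test are read off from it. *)
Lemma mixed_difference f x u v (e : R) : 0 < e ->
  (\forall y \near x, derivable f y u) ->
  (\forall y \near x, derivable ('D_u f) y v) ->
  {for x, continuous ('D_v ('D_u f))} ->
  \forall s \near (0 : R),
    `|f (s *: v + (s *: u + x)) - f (s *: u + x) - (f (s *: v + x) - f x)
      - s ^+ 2 * 'D_v ('D_u f) x| <= e * s ^+ 2.
Proof.
move=> e0 df ddf cddf.
have /nbhs_normP[r /= r0 H] : \forall y \near x,
    [/\ derivable f y u, derivable ('D_u f) y v &
    `|'D_v ('D_u f) x - 'D_v ('D_u f) y| <= e].
  move/cvgrPdist_le: cddf => /(_ _ e0) cddf.
  by apply: filterS3 df ddf cddf => y ? ? ?; split.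
have vu0 : 0 < `|v| + `|u| + 1 by rewrite ltr_wpDl ?addr_ge0.
have snear : \forall s \near (0 : R), `|s| < r / (`|v| + `|u| + 1).
  by apply: nbhs0_lt; rewrite divr_gt0.
near=> s.
have sr : `|s| * (`|v| + `|u| + 1) < r.
  by rewrite -ltr_pdivlMr //; near: s.
have inr t t' : `|t| <= `|s| -> `|t'| <= `|s| -> `|x - (t *: v + (t' *: u + x))| < r.
  move=> ts ts'; apply: le_lt_trans sr.
  rewrite addrA opprD addrCA subrr addr0 normrN.
  apply: (le_trans (ler_normD _ _)); rewrite !normrZ !mulrDr mulr1.
  by rewrite ler_wpDr // lerD //; exact: ler_wpM2r.
pose G y := f (s *: v + y) - f y.
have dG t : `|t| <= `|s| -> is_derive (t *: u + x) u G
   ('D_u f (s *: v + (t *: u + x)) - 'D_u f (t *: u + x)).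
  move=> ts; apply: is_deriveB.
    by apply: is_derive_translate; have [] := H _ (inr s t (lexx _) ts).
  apply: derivableP; rewrite -[X in derivable _ X]add0r -(scale0r v).
  by have [] := H _ (inr 0 t _ ts); rewrite ?normr0.
have [|t ts Gt] := @line_mvt _ _ G x u s.
  by move=> t ts; have [] := dG t ts.
have [|t' ts' Ft] := @line_mvt _ _ ('D_u f) (t *: u + x) v s.
  by move=> t' ts'; have [] := H _ (inr t' t ts' ts).
rewrite -/(G (s *: u + x)) -/(G x) Gt.
have [_ ->] := dG t ts; rewrite Ft.
rewrite mulrA -expr2 -mulrBr normrM ger0_norm ?sqr_ge0 // mulrC.
rewrite ler_wpM2r ?sqr_ge0 // distrC.
by have [] := H _ (inr t' t ts' ts).
Unshelve. all: by end_near. Qed.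

(** The second-order difference is symmetric in [u] and [v], so its two
    expansions agree to order [s^2]. *)
Lemma schwarz f x u v :
  (\forall y \near x, derivable f y u) -> (\forall y \near x, derivable f y v) ->
  (\forall y \near x, derivable ('D_u f) y v) ->
  (\forall y \near x, derivable ('D_v f) y u) ->
  {for x, continuous ('D_v ('D_u f))} -> {for x, continuous ('D_u ('D_v f))} ->
  'D_v ('D_u f) x = 'D_u ('D_v f) x.
Proof.
move=> du dv duv dvu cuv cvu; apply/eqP; rewrite -subr_eq0 -normr_le0.
apply/ler_addgt0Pl => e e0; rewrite addr0.
have e2 : 0 < e / 2 by rewrite divr_gt0.
have := mixed_difference e2 du duv cuv.
have := mixed_difference e2 dv dvu cvu.
move=> H1 H2.
have : \forall s \near (0 : R)^', `|'D_v ('D_u f) x - 'D_u ('D_v f) x| <= e.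
  apply: filterS2 H1 H2 => s h1 h2 s0.
  have s2 : 0 < s ^+ 2 by rewrite exprn_even_gt0.
  rewrite -(ler_pM2l s2) -[X in X * `|_|](ger0_norm (ltW s2)) -normrM.
  have vu : s *: v + (s *: u + x) = s *: u + (s *: v + x) by exact: addrCA.
  move: h1 h2; rewrite vu.
  move: (f (s *: u + (s *: v + x))) (f (s *: u + x)) (f (s *: v + x)) (f x) => F1 F2 F3 F4.
  move: ('D_v ('D_u f) x) ('D_u ('D_v f) x) (s ^+ 2) => D1 D2 S.
  rewrite ler_norml => /andP[? ?]; rewrite ler_norml => /andP[? ?].
  by rewrite ler_norml; apply/andP; split; lra.
by move=> /filter_ex[].
Qed.

(** With [u = v] and the second direction [- v], the second-order difference is
    [2 f x - f (x + s v) - f (x - s v)], which is nonnegative at a maximum. *)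
Lemma second_derivative_test f x v :
  (\forall y \near x, derivable f y v) ->
  (\forall y \near x, derivable ('D_v f) y v) ->
  {for x, continuous ('D_v ('D_v f))} ->
  (\forall y \near x, f y <= f x) ->
  'D_v ('D_v f) x <= 0.
Proof.
move=> df ddf cddf fmax.
have arith (F1 F2 F3 D S e : R) : F1 <= F2 -> F3 <= F2 ->
    `|F2 - F1 - (F3 - F2) - S * - D| <= e * S -> S * D <= S * e.
  by rewrite ler_norml => ? ? /andP[_ ?]; lra.
have ddfN : \forall y \near x, is_derive y (- v) ('D_v f) (- 'D_v ('D_v f) y).
  apply: filterS ddf => y /(is_derive_scale (- 1)).
  by rewrite scaleN1r mulN1r.
have cN : {for x, continuous ('D_(- v) ('D_v f))}.
  have E : \forall y \near x, - 'D_v ('D_v f) y = 'D_(- v) ('D_v f) y.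
    by apply: filterS ddfN => y [].
  have Ex : - 'D_v ('D_v f) x = 'D_(- v) ('D_v f) x by exact: nbhs_singleton E.
  rewrite /continuous_at /prop_for -Ex.
  apply: cvg_trans (near_eq_cvg E) _.
  by apply: cvgN; exact: cddf.
apply/ler_addgt0Pl => e e0; rewrite addr0.
have d2 : \forall y \near x, derivable ('D_v f) y (- v).
  by apply: filterS ddfN => y [].
have H := mixed_difference e0 df d2 cN.
have : \forall s \near (0 : R)^', 'D_v ('D_v f) x <= e.
  have line (w : E) : \forall s \near (0 : R), f (s *: w + x) <= f x.
    have c : {for (0 : R), continuous (fun s : R => s *: w + x)}.
      by apply: cvgD; [exact: scalel_continuous | exact: cvg_cst].
    by apply: (c (fun y => f y <= f x)); rewrite scale0r add0r.
  apply: filterS3 (line v) (line (- v)) H => s m1 m2 h s0.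
  have s2 : 0 < s ^+ 2 by rewrite exprn_even_gt0.
  move: h.
  have -> : 'D_(- v) ('D_v f) x = - 'D_v ('D_v f) x.
    have K : is_derive x (- v) ('D_v f) (- 'D_v ('D_v f) x) by exact: nbhs_singleton ddfN.
    by case: K.
  have -> : s *: - v + (s *: v + x) = x by rewrite scalerN addKr.
  by move=> h; rewrite -(ler_pM2l s2); exact: arith m1 m2 h.
by move=> /filter_ex[].
Qed.

End SecondOrder.

(** * Functions of class C^k on an open set *)

Section ContinuouslyDifferentiable.
Context {R : realType} {n : nat}.
Local Notation E := 'rV[R]_n.
Variable U : set E.
Hypothesis oU : open U.
Implicit Types (f g : E -> R) (x y v w : E) (k : nat) (i j : 'I_n).
Local Notation basis i := (delta_mx ord0 i : E).

(** [Ck k f]: on [U], the partial derivatives of [f] up to order [k] exist and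
    are continuous.  Recursion on the order, rather than on a list of indices,
    makes closure under products an induction. *)
Fixpoint Ck k f : Prop :=
  match k with
  | 0 => forall x, U x -> {for x, continuous f}
  | k.+1 => [/\ forall x, U x -> {for x, continuous f},
      forall i x, U x -> derivable f x (basis i) &
      forall i, Ck k (partial i f)]
  end.

Lemma nearU x : U x -> \forall y \near x, U y.
Proof. by move=> Ux; exact: (open_nbhs_nbhs (conj oU Ux)). Qed.

Lemma eq_near f g : (forall x, U x -> f x = g x) -> forall x, U x ->
  \forall y \near x, f y = g y.
Proof. by move=> fg x /nearU; apply: filterS. Qed.

Lemma eq_continuous f g : (forall x, U x -> f x = g x) -> forall x, U x ->
  {for x, continuous f} -> {for x, continuous g}.
Proof.
move=> fg x Ux; rewrite /prop_for /continuous_at -fg //.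
by move=> fc; apply: cvg_trans (near_eq_cvg (eq_near fg Ux)) fc.
Qed.

Lemma eq_partial f g : (forall x, U x -> f x = g x) -> forall i x, U x ->
  partial i f x = partial i g x.
Proof. by move=> fg i x Ux; apply: near_eq_derive; exact: eq_near. Qed.

Lemma eq_Ck k f g : (forall x, U x -> f x = g x) -> Ck k f -> Ck k g.
Proof.
elim: k f g => [|k IHk] f g fg; first by move=> fc x Ux; apply: eq_continuous (fc x Ux).
case=> fc fd fp; split.
- by move=> x Ux; apply: eq_continuous (fc x Ux).
- by move=> i x Ux; apply: near_eq_derivable (fd i x Ux); exact: eq_near.
- by move=> i; apply: IHk (fp i) => x Ux; exact: eq_partial.
Qed.

Lemma CkW k f : Ck k.+1 f -> Ck k f.
Proof.
by elim: k f => [|k IHk] f [fc fd fp] //; split => // i; exact: IHk.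
Qed.

Lemma Ck_continuous k f : Ck k f -> forall x, U x -> {for x, continuous f}.
Proof. by case: k => [|k] // []. Qed.

Lemma smooth_Ck k f : smooth_on U f -> Ck k f.
Proof.
elim: k f => [|k IHk] f sf; first by move=> x /(sf [::])[].
split; [by move=> x /(sf [::])[] | by move=> i x /(sf [::])[]|].
move=> i; apply: IHk => s x Ux; have := sf (rcons s i) x Ux.
by rewrite /partials foldr_rcons.
Qed.

Lemma partialD f g i x : derivable f x (basis i) -> derivable g x (basis i) ->
  partial i (fun y => f y + g y) x = partial i f x + partial i g x.
Proof. exact: deriveD. Qed.

Lemma partialN f i x : derivable f x (basis i) ->
  partial i (fun y => - f y) x = - partial i f x.
Proof. exact: deriveN. Qed.

Lemma partialM f g i x : derivable f x (basis i) -> derivable g x (basis i) ->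
  partial i (fun y => f y * g y) x = partial i f x * g x + f x * partial i g x.
Proof.
move=> df dg; rewrite /partial (deriveM df dg) /GRing.scale /=; ring.
Qed.

Lemma is_derive_partial f i x (d : R) :
  is_derive x (basis i) f d -> partial i f x = d.
Proof. by case. Qed.

Lemma partial_cst i (c : R) x : partial i (fun=> c) x = 0.
Proof. exact: derive_cst. Qed.

Lemma Ck_cst k (c : R) : Ck k (fun=> c).
Proof.
elim: k c => [|k IHk] c; first by move=> x _; exact: cst_continuous.
split; [by move=> x _; exact: cst_continuous | by move=> i x _; exact: derivable_cst|].
move=> i; apply: eq_Ck (IHk 0) => x _; by rewrite partial_cst.
Qed.

Lemma CkD k f g : Ck k f -> Ck k g -> Ck k (fun x => f x + g x).
Proof.
elim: k f g => [|k IHk] f g.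
  by move=> fc gc x Ux; apply: continuousD; [exact: fc | exact: gc].
move=> [fc fd fp] [gc gd gp]; split.
- by move=> x Ux; apply: continuousD; [exact: fc | exact: gc].
- by move=> i x Ux; apply: derivableD; [exact: fd | exact: gd].
- move=> i; apply: eq_Ck (IHk _ _ (fp i) (gp i)) => x Ux.
  by rewrite partialD //; [exact: fd | exact: gd].
Qed.

Lemma CkM k f g : Ck k f -> Ck k g -> Ck k (fun x => f x * g x).
Proof.
elim: k f g => [|k IHk] f g.
  by move=> fc gc x Ux; apply: continuousM; [exact: fc | exact: gc].
move=> Cf Cg; have := (Cf, Cg) => -[[fc fd fp] [gc gd gp]]; split.
- by move=> x Ux; apply: continuousM; [exact: fc | exact: gc].
- by move=> i x Ux; apply: derivableM; [exact: fd | exact: gd].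
- move=> i; apply: eq_Ck (CkD (IHk _ _ (fp i) (CkW Cg)) (IHk _ _ (CkW Cf) (gp i))).
  by move=> x Ux; rewrite partialM //; [exact: fd | exact: gd].
Qed.

Lemma CkN k f : Ck k f -> Ck k (fun x => - f x).
Proof.
move=> Cf; apply: eq_Ck (CkM (Ck_cst k (- 1)) Cf) => x _; by rewrite mulN1r.
Qed.

Lemma CkB k f g : Ck k f -> Ck k g -> Ck k (fun x => f x - g x).
Proof. by move=> Cf Cg; apply: CkD => //; exact: CkN. Qed.

Lemma CkV k f : (forall x, U x -> f x != 0) -> Ck k f -> Ck k (fun x => (f x)^-1).
Proof.
move=> f0; elim: k => [|k IHk].
  by move=> fc x Ux; apply: continuousV; [exact: f0 | exact: fc].
move=> Cf; have := Cf => -[fc fd fp]; split.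
- by move=> x Ux; apply: continuousV; [exact: f0 | exact: fc].
- by move=> i x Ux; apply: derivableV; [exact: f0 | exact: fd].
- have Ci := IHk (CkW Cf); move=> i.
  apply: eq_Ck (CkM (CkN (CkM Ci Ci)) (fp i)) => x Ux.
  rewrite /partial deriveV; [|exact: f0|exact: fd].
  by rewrite /GRing.scale /= expr2 invfM.
Qed.

Lemma Ck_sum k (I : Type) (r : seq I) (F : I -> E -> R) :
  (forall a, Ck k (F a)) -> Ck k (fun x => \sum_(a <- r) F a x).
Proof.
move=> CF; elim: r => [|a r IHr].
  by apply: eq_Ck (Ck_cst k 0) => x _; rewrite big_nil.
by apply: eq_Ck (CkD (CF a) IHr) => x _; rewrite big_cons.
Qed.

Lemma Ck_prod k (I : Type) (r : seq I) (F : I -> E -> R) :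
  (forall a, Ck k (F a)) -> Ck k (fun x => \prod_(a <- r) F a x).
Proof.
move=> CF; elim: r => [|a r IHr].
  by apply: eq_Ck (Ck_cst k 1) => x _; rewrite big_nil.
by apply: eq_Ck (CkM (CF a) IHr) => x _; rewrite big_cons.
Qed.

Lemma is_derive_coord i j x :
  is_derive x (basis j) (fun y : E => y ord0 i) ((i == j)%:R : R).
Proof.
apply: is_derive_line.
have -> : (fun h : R => (h *: basis j + x) ord0 i) =
   (fun h : R => h * (i == j)%:R + x ord0 i).
  by apply/funext => h; rewrite !mxE /=.
have : is_derive (0 : R) 1 ((i == j)%:R \*: (id : R -> R) + cst (x ord0 i))
    ((i == j)%:R *: 1 + 0).
  by apply: is_deriveD; apply: is_deriveZ.
have -> : (i == j)%:R \*: (id : R -> R) + cst (x ord0 i)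
    = (fun h => h * (i == j)%:R + x ord0 i).
  by apply/funext => h; rewrite /= mulrC.
by rewrite addr0 [_ *: 1]mulr1.
Qed.

Lemma Ck_coord k i : Ck k (fun x => x ord0 i).
Proof.
case: k => [|k]; first by move=> x _; exact: coord_continuous.
split; [by move=> x _; exact: coord_continuous | by move=> j x _; have [] := is_derive_coord i j x|].
move=> j; apply: eq_Ck (Ck_cst k (i == j)%:R) => x _.
by have [_ <-] := is_derive_coord i j x.
Qed.

Lemma partial_sum (I : finType) (F : I -> E -> R) i x :
  (forall a, derivable (F a) x (basis i)) ->
  partial i (fun y => \sum_a F a y) x = \sum_a partial i (F a) x.
Proof.
move=> dF; suff: is_derive x (basis i) (fun y => \sum_a F a y)
   (\sum_a partial i (F a) x) by case.
elim: (index_enum I) => [|a r IHr].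
  rewrite big_nil (_ : (fun y => _) = cst 0); first exact: is_derive_cst.
  by apply/funext => y; rewrite big_nil.
rewrite big_cons (_ : (fun y => _) = F a + (fun y => \sum_(a <- r) F a y)).
  by apply: is_deriveD => //; exact: derivableP.
by apply/funext => y; rewrite big_cons.
Qed.

(** Continuous partial derivatives give all directional derivatives, by adding
    one coordinate direction at a time with [is_derive_add]. *)
Lemma C1_is_derive f x v : Ck 1 f -> U x ->
  is_derive x v f (\sum_i v ord0 i * partial i f x).
Proof.
move=> [fc fd fp] Ux.
have dZ i (c : R) y : U y -> is_derive y (c *: basis i) f (c * partial i f y).
  by move=> Uy; apply: is_derive_scale; exact: fd.
rewrite [v in is_derive x v](row_sum_delta v).
suff : forall r : seq 'I_n, is_derive x (\sum_(i <- r) v ord0 i *: basis i) f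
   (\sum_(i <- r) v ord0 i * partial i f x) by exact.
elim=> [|i r IHr]; first by rewrite !big_nil; exact: is_derive0.
rewrite !big_cons.
have [_ <-] := dZ i (v ord0 i) x Ux; have [_ <-] := IHr.
apply: is_derive_add.
- by apply: filterS (nearU Ux) => y /(dZ i (v ord0 i))[].
- apply: (@eq_continuous (fun y => v ord0 i * partial i f y)) => //.
    by move=> y /(dZ i (v ord0 i))[].
  by apply: continuousM; [exact: cst_continuous | exact: fp].
- by have [] := IHr.
Qed.

Lemma C2_derive f v : Ck 2 f -> Ck 1 ('D_v f).
Proof.
move=> Cf; have := Cf => -[_ _ fp].
apply: (@eq_Ck _ (fun x => \sum_i v ord0 i * partial i f x)).
  by move=> x Ux; have [_ ->] := C1_is_derive v (CkW Cf) Ux.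
by apply: Ck_sum => i; apply: CkM => //; exact: Ck_cst.
Qed.

Lemma C2_hessian f x v w : Ck 2 f -> U x ->
  'D_w ('D_v f) x =
  \sum_j \sum_i w ord0 j * v ord0 i * partial j (partial i f) x.
Proof.
move=> Cf Ux; have := Cf => -[_ _ fp].
have [_ ->] := C1_is_derive w (C2_derive v Cf) Ux.
apply: eq_bigr => j _.
rewrite (@eq_partial _ (fun x => \sum_i v ord0 i * partial i f x)) //; last first.
  by move=> y Uy; have [_ ->] := C1_is_derive v (CkW Cf) Uy.
have d i : derivable (partial i f) x (basis j) by have [_ + _] := fp i; exact.
rewrite partial_sum; last first.
  by move=> i; apply: derivableM => //; exact: derivable_cst.
rewrite mulr_sumr; apply: eq_bigr => i _.
by rewrite partialM // ?partial_cst ?mul0r ?add0r ?mulrA //; exact: derivable_cst.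
Qed.

Lemma C2_partialC f x i j : Ck 2 f -> U x ->
  partial i (partial j f) x = partial j (partial i f) x.
Proof.
move=> [fc fd fp] Ux.
have n1 a : \forall y \near x, derivable f y (basis a).
  by apply: filterS (nearU Ux) => y; exact: fd.
have n2 a b : \forall y \near x, derivable (partial a f) y (basis b).
  by apply: filterS (nearU Ux) => y; have [_ + _] := fp a; exact.
apply: schwarz => //; try exact: n2.
  by have [_ _ /(_ i)] := fp j; exact.
by have [_ _ /(_ j)] := fp i; exact.
Qed.

Lemma C2_max_hessian f x v : Ck 2 f -> U x ->
  (\forall y \near x, f y <= f x) ->
  \sum_j \sum_i v ord0 j * v ord0 i * partial j (partial i f) x <= 0.
Proof.
move=> Cf Ux fmax; rewrite -C2_hessian //.
have C1 := C2_derive v Cf.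
apply: second_derivative_test => //.
- by apply: filterS (nearU Ux) => y /(C1_is_derive v (CkW Cf))[].
- by apply: filterS (nearU Ux) => y /(C1_is_derive v C1)[].
- apply: (@eq_continuous (fun x => \sum_i v ord0 i * partial i ('D_v f) x)) => //.
    by move=> y /(C1_is_derive v C1)[].
  have [_ _ C0] := C1.
  have /(_ x Ux) : Ck 0 (fun x => \sum_i v ord0 i * partial i ('D_v f) x).
    by apply: (@Ck_sum 0) => i; exact: (CkM (Ck_cst 0 (v ord0 i)) (C0 i)).
  exact.
Qed.

Lemma max_partial_eq0 f x i : Ck 1 f -> U x ->
  (\forall y \near x, f y <= f x) -> partial i f x = 0.
Proof.
move=> Cf Ux fmax; have [_ fd _] := Cf.
have c : {for (0 : R), continuous (fun t : R => t *: basis i + x)}.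
  by apply: cvgD; [exact: scalel_continuous | exact: cvg_cst].
have /c : \forall y \near (0 *: basis i + x), U y /\ f y <= f x.
  by rewrite scale0r add0r; apply: filterI fmax; exact: nearU.
move=> /nbhs_normP[d /= d0 H].
have Hd t : t \in `]- d, d[%R -> U (t *: basis i + x) /\ f (t *: basis i + x) <= f x.
  rewrite in_itv /= => td; apply: (H t).
  by rewrite /= sub0r normrN ltr_norml.
have := @derive1_at_max R (fun t => f (t *: basis i + x)) (- d) d 0.
rewrite scale0r add0r => /(_ _ _ _ _)[].
- by rewrite -subr_ge0 opprK addr_ge0 // ltW.
- by move=> t /Hd[Ut _]; have [] := line_is_derive (fd i _ Ut).
- by rewrite in_itv /= oppr_lt0 d0.
- by move=> t /Hd[].
have Ux0 : U (0 *: basis i + x) by rewrite scale0r add0r.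
have [_ E] := line_is_derive (fd i _ Ux0).
by move=> _; rewrite E scale0r add0r.
Qed.

End ContinuouslyDifferentiable.

(** * Elliptic operators and the barrier function *)

Section EuclideanDistance.
Context {R : realType} {n : nat}.
Local Notation E := 'rV[R]_n.
Implicit Types (x y q : E) (r : R).

Definition sqdist q x : R := \sum_i (x ord0 i - q ord0 i) ^+ 2.

Lemma sqdist_ge0 q x : 0 <= sqdist q x.
Proof. by apply: sumr_ge0 => i _; exact: sqr_ge0. Qed.

Lemma sqdist_coord q x i : (x ord0 i - q ord0 i) ^+ 2 <= sqdist q x.
Proof.
rewrite /sqdist (bigD1 i) //= lerDl.
by apply: sumr_ge0 => j _; exact: sqr_ge0.
Qed.

Lemma norm_rV_le x r : 0 <= r -> (forall i, `|x ord0 i| <= r) -> `|x| <= r.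
Proof.
move=> r0 H; rewrite [leLHS]/Num.norm /= mx_normrE.
by apply/bigmax_leP; split => // -[i j] _ /=; rewrite ord1.
Qed.

Lemma sqdist_norm q x r : 0 <= r -> sqdist q x <= r ^+ 2 -> `|x - q| <= r.
Proof.
move=> r0 H; apply: norm_rV_le => // i; rewrite !mxE.
rewrite -(@ler_pXn2r _ 2) ?nnegrE // real_normK ?num_real //.
exact: le_trans (sqdist_coord q x i) H.
Qed.

Lemma sqdist_Ck k q (U : set E) : open U -> Ck U k (sqdist q).
Proof.
move=> oU; apply: Ck_sum => // i.
have C : Ck U k (fun x : E => x ord0 i - q ord0 i).
  by apply: CkB => //; [exact: Ck_coord | exact: Ck_cst].
by apply: eq_Ck (CkM oU C C).
Qed.

Lemma sqdist_continuous q : continuous (sqdist q).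
Proof. by move=> x; exact: (Ck_continuous (sqdist_Ck 0 q openT)). Qed.

End EuclideanDistance.

Section MaximumPrinciple.
Context {R : realType} {n : nat}.
Local Notation E := 'rV[R]_n.
Variable U : set E.
Hypothesis oU : open U.
Variables (a : E -> 'M[R]_n) (b : E -> 'I_n -> R).
Hypothesis a_sym : forall x, U x -> (a x)^T = a x.
Hypothesis a_pos : forall x, U x -> posdefmx (a x).

Definition elliptic_op (f : E -> R) (x : E) : R :=
  \sum_i \sum_j a x i j * partial i (partial j f) x + \sum_i b x i * partial i f x.

Lemma elliptic_opD f g x (c : R) : Ck U 2 f -> Ck U 2 g -> U x ->
  elliptic_op (fun y => f y + c * g y) x = elliptic_op f x + c * elliptic_op g x.
Proof.
move=> Cf Cg Ux.
have Cc : Ck U 2 (fun=> c : R) by exact: Ck_cst.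
have p i y : U y ->
    partial i (fun z => f z + c * g z) y = partial i f y + c * partial i g y.
  move=> Uy; have [_ fd _] := Cf; have [_ gd _] := Cg; have [_ cd _] := Cc.
  rewrite partialD; [|exact: fd|by apply: derivableM; [exact: cd | exact: gd]].
  by rewrite partialM; [|exact: cd|exact: gd]; rewrite partial_cst mul0r add0r.
have pp i j : partial i (partial j (fun z => f z + c * g z)) x =
    partial i (partial j f) x + c * partial i (partial j g) x.
  rewrite (eq_partial oU (p j)) //.
  have [_ _ /(_ j)[_ fd _]] := Cf; have [_ _ /(_ j)[_ gd _]] := Cg.
  have [_ cd _] := Cc.
  rewrite partialD; [|exact: fd|by apply: derivableM; [exact: cd | exact: gd]].
  by rewrite partialM; [|exact: cd|exact: gd]; rewrite partial_cst mul0r add0r.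
rewrite /elliptic_op mulrDr addrACA; congr (_ + _).
  rewrite mulr_sumr -big_split; apply: eq_bigr => i _ /=.
  rewrite mulr_sumr -big_split; apply: eq_bigr => j _ /=.
  by rewrite pp mulrDr mulrCA.
rewrite mulr_sumr -big_split; apply: eq_bigr => i _ /=.
by rewrite p // mulrDr mulrCA.
Qed.

(** At a maximum the gradient vanishes and the Hessian is negative semidefinite.
    Writing [a x = C^T C] makes the second-order part a sum of second derivatives
    along the rows of [C]. *)
Lemma max_elliptic_op_le0 w x : Ck U 2 w -> U x ->
  (\forall y \near x, w y <= w x) -> elliptic_op w x <= 0.
Proof.
move=> Cw Ux wmax; rewrite /elliptic_op [X in _ + X]big1 ?addr0; last first.
  by move=> i _; rewrite (max_partial_eq0 oU) ?mulr0 //; exact: CkW.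
have [B [_ [BaB _]]] := simultaneous_diagonalization (a_sym Ux) (a_pos Ux) (trmx1 _ _).
have [BaU BTU] := mulmx1_unit BaB.
have BU : B \in unitmx by rewrite -unitmx_tr.
pose C := (invmx B)^T.
have aE : a x = C^T *m C.
  rewrite /C trmxK; apply: (can_inj (mulKmx BU)); rewrite mulKVmx //.
  by rewrite trmx_inv -[RHS]mul1mx -BaB mulmxK.
pose H := \matrix_(i, j) partial i (partial j w) x.
apply: (@le_trans _ _ (\sum_i \sum_j H i j * (C^T *m C) i j)); last first.
  rewrite sum_gram; apply: sumr_le0 => k _.
  have := C2_max_hessian oU (row k C) Cw Ux wmax.
  apply: le_trans; rewrite le_eqVlt; apply/orP; left; apply/eqP.
  apply: eq_bigr => i _; apply: eq_bigr => j _; rewrite !mxE; ring.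
rewrite le_eqVlt; apply/orP; left; apply/eqP.
by rewrite -aE; apply: eq_bigr => i _; apply: eq_bigr => j _; rewrite mxE mulrC.
Qed.

Variables (q : E) (rho : R).
Local Notation u := (fun x => rho - sqdist q x).
(** A polynomial substitute for the exponential barrier of Hopf: it is positive
    inside the ball of squared radius [rho] around [q] and vanishes on its
    boundary. *)
Definition barrier N : E -> R := fun x => u x ^+ N.

Lemma barrier_Ck k N (V : set E) : open V -> Ck V k (barrier N).
Proof.
move=> oV; elim: N => [|N IHN].
  by apply: (eq_Ck oV) (Ck_cst oV k 1) => x _; rewrite /barrier expr0.
apply: (eq_Ck oV) (CkM oV _ IHN) => [x _|]; first by rewrite /barrier exprS.
by apply: CkB => //; [exact: Ck_cst | exact: sqdist_Ck].
Qed.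

Lemma is_derive_coordB i j x : is_derive x (delta_mx ord0 j)
  (fun y : E => y ord0 i - q ord0 i) ((i == j)%:R : R).
Proof.
rewrite -[X in is_derive _ _ _ X]subr0; by apply: is_deriveB; exact: is_derive_coord.
Qed.

Lemma partial_sqdist i x : partial i (sqdist q) x = 2 * (x ord0 i - q ord0 i).
Proof.
have d j : derivable (fun y : E => y ord0 j - q ord0 j) x (delta_mx ord0 i).
  by have [] := is_derive_coordB j i x.
have p j : partial i (fun y : E => y ord0 j - q ord0 j) x = (j == i)%:R.
  exact: is_derive_partial (is_derive_coordB j i x).
have d2 j : derivable (fun y : E => (y ord0 j - q ord0 j) * (y ord0 j - q ord0 j))
  x (delta_mx ord0 i) by exact: derivableM.
have -> : sqdist q = fun y => \sum_j (y ord0 j - q ord0 j) * (y ord0 j - q ord0 j).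
  by apply/funext.
rewrite partial_sum // (bigD1 i) //= big1 ?addr0 => [|j ji].
  by rewrite partialM // p eqxx /=; ring.
by rewrite partialM // p (negbTE ji) mul0r mulr0 addr0.
Qed.

Lemma barrier_derivable N i x : derivable (barrier N) x (delta_mx ord0 i).
Proof. by have [_ + _] := barrier_Ck 1 N (@openT E); exact. Qed.

Lemma partial_barrier N i x : partial i (barrier N.+1) x =
  - (2 * N.+1%:R) * (barrier N x * (x ord0 i - q ord0 i)).
Proof.
have ds : derivable (sqdist q) x (delta_mx ord0 i).
  by have [_ + _] := sqdist_Ck 1 q (@openT E); exact.
have dc : derivable (fun=> rho : R) x (delta_mx ord0 i) by exact: derivable_cst.
have dN := derivableN ds.
have du : derivable u x (delta_mx ord0 i) := derivableD dc dN.
have pu : partial i u x = - (2 * (x ord0 i - q ord0 i)).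
  have -> : partial i u x = _ := partialD dc dN.
  by rewrite partial_cst (partialN ds) partial_sqdist add0r.
elim: N => [|N IHN].
  have -> : barrier 1 = u by apply/funext => y; rewrite /barrier expr1.
  by rewrite pu /barrier expr0; ring.
have -> : barrier N.+2 = fun y => u y * barrier N.+1 y.
  by apply/funext => y; rewrite /barrier exprS.
rewrite (partialM du (@barrier_derivable N.+1 i x)).
rewrite pu IHN [N.+2%:R]mulrS.
by rewrite [barrier N.+1 x]exprS -/(barrier N x); ring.
Qed.

Lemma partial2_barrier N i j x : partial i (partial j (barrier N.+2)) x =
  (2 * N.+2%:R) * (2 * N.+1%:R * barrier N x * (x ord0 i - q ord0 i) * (x ord0 j - q ord0 j)
    - barrier N.+1 x * (i == j)%:R).
Proof.
have -> : partial j (barrier N.+2) = fun y =>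
    - (2 * N.+2%:R) * (barrier N.+1 y * (y ord0 j - q ord0 j)).
  by apply/funext => y; exact: partial_barrier.
have [d _] := is_derive_coordB j i x.
have p := is_derive_partial (is_derive_coordB j i x).
have db := @barrier_derivable N.+1 i x.
have dc : derivable (fun=> - (2 * N.+2%:R) : R) x (delta_mx ord0 i).
  exact: derivable_cst.
rewrite (partialM dc (derivableM db d)).
by rewrite partial_cst (partialM db d) partial_barrier p eq_sym; ring.
Qed.

(** The second-order part carries a factor [N] more than the remaining terms,
    which is what makes the barrier a strict subsolution for large [N]. *)
Lemma elliptic_op_barrier N x (y := x - q) :
  elliptic_op (barrier N.+2) x = 2 * N.+2%:R * barrier N x *
   (2 * N.+1%:R * (y *m a x *m y^T) ord0 ord0
    - u x * (\tr (a x) + \sum_i b x i * y ord0 i)).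
Proof.
rewrite /elliptic_op.
have yE i : x ord0 i - q ord0 i = y ord0 i by rewrite !mxE.
have S2 : \sum_i b x i * partial i (barrier N.+2) x =
   - (2 * N.+2%:R * barrier N x * u x) * \sum_i b x i * y ord0 i.
  rewrite mulr_sumr; apply: eq_bigr => i _; rewrite partial_barrier yE.
  by rewrite [barrier N.+1 x]exprS -/(barrier N x); ring.
have S1 : \sum_i \sum_j a x i j * partial i (partial j (barrier N.+2)) x =
   2 * N.+2%:R * barrier N x * (2 * N.+1%:R * (y *m a x *m y^T) ord0 ord0
     - u x * \tr (a x)).
  rewrite mulmx3E /mxtrace !mulr_sumr -sumrB mulr_sumr; apply: eq_bigr => i _.
  have -> : u x * a x i i = \sum_j u x * a x i j * (i == j)%:R.
    rewrite (bigD1 i) //= eqxx mulr1 big1 ?addr0 // => j /negbTE.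
    by rewrite eq_sym => ->; rewrite mulr0.
  rewrite mulr_sumr -sumrB mulr_sumr; apply: eq_bigr => j _.
  rewrite partial2_barrier !yE [y^T _ _]mxE.
  by rewrite [barrier N.+1 x]exprS -/(barrier N x); ring.
by rewrite S1 S2; ring.
Qed.

End MaximumPrinciple.

(** * The strong maximum principle *)

Section StrongMaximumPrinciple.
Context {R : realType} {n : nat}.
Local Notation E := 'rV[R]_n.
Variable U : set E.
Hypothesis oU : open U.
Variables (a : E -> 'M[R]_n) (b : E -> 'I_n -> R).
Hypothesis a_cont : forall i j, Ck U 0 (fun x => a x i j).
Hypothesis b_cont : forall i, Ck U 0 (fun x => b x i).
Hypothesis a_sym : forall x, U x -> (a x)^T = a x.
Hypothesis a_pos : forall x, U x -> posdefmx (a x).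
Local Notation L := (elliptic_op a b).

(** The interior maximum is sought on this annulus; its inner radius keeps
    [x - q] away from zero, where the leading term of the barrier degenerates. *)
Lemma annulus_compact (q : E) (d rho : R) :
  compact [set x | d <= sqdist q x /\ sqdist q x <= rho].
Proof.
apply: bounded_closed_compact.
  exists (`|rho| + 1 + `|q|); split=> [|M MM x [_ /= xr]]; first exact: num_real.
  apply: le_trans (ltW MM); rewrite -[x](subrK q).
  apply: (le_trans (ler_normD _ _)); rewrite lerD2r; apply: sqdist_norm.
    by rewrite addr_ge0.
  apply: (le_trans xr); apply: (le_trans (ler_norm _)).
  by have := normr_ge0 rho; nra.
have -> : [set x | d <= sqdist q x /\ sqdist q x <= rho] =
    sqdist q @^-1` [set t | d <= t] `&` sqdist q @^-1` [set t | t <= rho].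
  by apply/seteqP; split => x.
apply: closedI; apply: closed_comp.
- by move=> x _; exact: sqdist_continuous.
- exact: closed_ge.
- by move=> x _; exact: sqdist_continuous.
- exact: closed_le.
Qed.

(** On the compact annulus the quotient of the lower-order terms by the quadratic
    form [a] is bounded, and [N] is taken larger than that bound. *)
Lemma barrier_subsolution (q : E) (d rho : R) : 0 < d ->
  (forall x, sqdist q x <= rho -> U x) ->
  exists N, forall x, d <= sqdist q x -> sqdist q x < rho ->
    0 < L (barrier q rho N.+2) x.
Proof.
move=> d0 HU; pose A := [set x | d <= sqdist q x /\ sqdist q x <= rho].
pose quad x : R := ((x - q) *m a x *m (x - q)^T) ord0 ord0.
pose low x : R := (rho - sqdist q x) * (\tr (a x) + \sum_i b x i * (x - q) ord0 i).
have AU x : A x -> U x by case=> _; exact: HU.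
have quad_gt0 x : A x -> 0 < quad x.
  move=> Ax; have [xd _] := Ax; apply: a_pos; first exact: AU.
  apply: contraTneq xd => /eqP; rewrite subr_eq0 => /eqP ->.
  by rewrite -ltNge /sqdist big1 // => i _; rewrite subrr expr0n.
have Cc i : Ck U 0 (fun x : E => (x - q) ord0 i).
  apply: (eq_Ck oU) (CkB oU (Ck_coord oU 0 i) (Ck_cst oU 0 (q ord0 i))) => x _.
  by rewrite !mxE.
have Cquad : Ck U 0 quad.
  apply: (@eq_Ck _ _ _ oU 0 (fun x => \sum_i \sum_j (x - q) ord0 i * a x i j * (x - q) ord0 j)).
    move=> x _; rewrite /quad mulmx3E; apply: eq_bigr => i _; apply: eq_bigr => j _.
    by rewrite [_^T _ _]mxE.
  have C1 i j : Ck U 0 (fun x => (x - q) ord0 i * a x i j * (x - q) ord0 j).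
    exact (@CkM _ _ U oU 0 _ _ (@CkM _ _ U oU 0 _ _ (Cc i) (@a_cont i j)) (Cc j)).
  have C2 i := @Ck_sum _ _ U oU 0 _ (index_enum _) _ (C1 i).
  exact (@Ck_sum _ _ U oU 0 _ (index_enum _) _ C2).
have Clow : Ck U 0 low.
  have C1 : Ck U 0 (fun x => rho - sqdist q x).
    exact: (CkB oU (Ck_cst oU 0 rho) (sqdist_Ck 0 q oU)).
  have C2 : Ck U 0 (fun x => \tr (a x)).
    exact: (@Ck_sum _ _ U oU 0 _ _ _ (fun i => @a_cont i i)).
  have C3 : Ck U 0 (fun x => \sum_i b x i * (x - q) ord0 i).
    exact: (@Ck_sum _ _ U oU 0 _ _ _ (fun i => @CkM _ _ U oU 0 _ _ (@b_cont i) (Cc i))).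
  exact: (@CkM _ _ U oU 0 _ _ C1 (@CkD _ _ U oU 0 _ _ C2 C3)).
suff [N HN] : exists N : nat, forall x, A x -> low x < 2 * N.+1%:R * quad x.
  exists N => x xd xr; have Ax : A x by split => //; exact: ltW.
  rewrite elliptic_op_barrier; apply: mulr_gt0; last by rewrite subr_gt0; exact: HN.
  by apply: mulr_gt0; [exact: mulr_gt0 | rewrite exprn_gt0 // subr_gt0].
have [[x0 Ax0]|A0] := pselect (A !=set0); last first.
  by exists 0%N => x Ax; exfalso; apply: A0; exists x.
have rc : {within A, continuous (fun x => low x / quad x)}.
  apply: continuous_in_subspaceT => x /set_mem Ax.
  apply: (@continuousM _ _ low (fun x => (quad x)^-1)).
    by apply: Clow; exact: AU.
  apply: continuousV; first by rewrite gt_eqF // quad_gt0.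
  by apply: Cquad; exact: AU.
have [z _ zmax] := EVT_max_rV (ex_intro _ x0 Ax0) (@annulus_compact q d rho) rc.
(* By [elliptic_op_barrier] the sign is that of [2 (N + 1) quad - low]. *)
exists (Num.bound `|low z / quad z|) => x Ax.
rewrite -ltr_pdivrMr ?quad_gt0 //; apply: le_lt_trans (zmax x _) _.
  exact: mem_set.
apply: (@le_lt_trans _ _ `|low z / quad z|); first exact: ler_norm.
apply: (lt_le_trans (archi_boundP (normr_ge0 _))).
rewrite -natrM ler_nat; apply: leq_trans (leqnSn _) _; exact: leq_pmull.
Qed.

(** If [F q < F x0], consider [w = F + e * barrier] on an annulus around [q] that
    contains [x0].  For small [e] it is below [F x0] on the inner sphere; it is at
    most [F x0] on the outer one, where the barrier vanishes; and it exceeds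
    [F x0] at [x0].  So [w] has an interior maximum, which contradicts [L w > 0]. *)
Lemma annulus_comparison (F : E -> R) (q x0 : E) (rho : R) :
  (forall x, sqdist q x <= rho -> U x) -> Ck U 2 F ->
  (forall x, U x -> F x <= F x0) -> (forall x, U x -> 0 <= L F x) ->
  sqdist q x0 < rho -> F q = F x0.
Proof.
move=> HU CF Fmax LF x0r; apply/eqP; rewrite eq_le Fmax /=; last first.
  apply: HU; rewrite {1}/sqdist big1 => [|i _]; last by rewrite subrr expr0n.
  exact: le_trans (sqdist_ge0 _ _) (ltW x0r).
rewrite leNgt; apply/negP => Fq.
have rho0 : 0 < rho by exact: le_lt_trans (sqdist_ge0 _ _) x0r.
have Uq : U q.
  by apply: HU; rewrite /sqdist big1 ?ltW // => i _; rewrite subrr expr0n.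
pose eta := (F x0 - F q) / 2.
have eta0 : 0 < eta by rewrite divr_gt0 // subr_gt0.
have [d d0 Hd] : exists2 d : R, 0 < d & forall x, sqdist q x <= d -> F x < F x0 - eta.
  have : \forall x \near q, F x < F x0 - eta.
    have c : {for q, continuous F} := Ck_continuous CF Uq.
    by apply: (cvgr_lt _ c); rewrite /eta; lra.
  move=> /nbhs_normP[r /= r0 Hr]; exists ((r / 2) ^+ 2).
    by rewrite exprn_gt0 // divr_gt0.
  move=> x /sqdist_norm xq; apply: Hr; rewrite /= distrC.
  by apply: (le_lt_trans (xq _)); lra.
have x0d : d < sqdist q x0.
  rewrite ltNge; apply/negP => /Hd; lra.
have [N HN] := barrier_subsolution d0 HU.
set h := barrier q rho N.+2 in HN.
have rN0 : 0 < rho ^+ N.+2 by rewrite exprn_gt0.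
(* The barrier is at most [rho ^+ N.+2], so [e * barrier <= eta], the margin by
   which [F] stays below [F x0] on the inner ball. *)
pose e := eta / rho ^+ N.+2; have e0 : 0 < e by rewrite divr_gt0.
have Ch : Ck U 2 h by exact: barrier_Ck.
pose w x := F x + e * h x.
have Cw : Ck U 2 w := CkD oU CF (CkM oU (Ck_cst oU 2 e) Ch).
pose A := [set x | d <= sqdist q x /\ sqdist q x <= rho].
have wc : {within A, continuous w}.
  apply: continuous_in_subspaceT => x /set_mem [_ xr].
  by apply: (Ck_continuous Cw); exact: HU.
have Ax0 : A x0 by split; exact: ltW.
have [z /set_mem [zd zr] zmax] := EVT_max_rV (ex_intro _ x0 Ax0) (@annulus_compact q d rho) wc.
have Uz : U z by exact: HU.
have wz : F x0 < w z.
  apply: lt_le_trans (zmax x0 (mem_set Ax0)).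
  by rewrite /w ltrDl mulr_gt0 // exprn_gt0 // subr_gt0.
have zr' : sqdist q z < rho.
  rewrite lt_neqAle zr andbT; apply: contraTneq wz => zr'.
  by rewrite -leNgt /w /h /barrier zr' subrr expr0n mulr0 addr0 Fmax.
have hz : h z <= rho ^+ N.+2.
  apply: lerXn2r; rewrite ?nnegrE ?subr_ge0 //; first exact: ltW.
  by rewrite gerBl sqdist_ge0.
have zd' : d < sqdist q z.
  rewrite lt_neqAle zd andbT; apply: contraTneq wz => zd'.
  rewrite -leNgt /w; have := Hd z; rewrite -zd' lexx => /(_ isT).
  have : e * h z <= eta.
    by rewrite /e mulrAC ler_pdivrMr // ler_wpM2l // ltW.
  move: (F z) (F x0) (e * h z) (eta) => *; lra.
have : L w z <= 0.
  apply: (max_elliptic_op_le0 oU b a_sym a_pos Cw Uz).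
  have c := @sqdist_continuous R n q z.
  have n1 : \forall y \near z, d < sqdist q y.
    by apply: (cvgr_gt _ c); exact: zd'.
  have n2 : \forall y \near z, sqdist q y < rho.
    by apply: (cvgr_lt _ c); exact: zr'.
  apply: filterS2 n1 n2 => y yd yr.
  by apply: zmax; apply: mem_set; split; exact: ltW.
rewrite (elliptic_opD oU a b e CF Ch Uz) leNgt => /negP; apply.
rewrite ltr_wpDl ?LF // mulr_gt0 // HN //.
Qed.

(** Every [q] close to [x0] is the centre of an annulus in [U] that contains
    [x0]. *)
Theorem strong_maximum_principle (F : E -> R) (x0 : E) : U x0 -> Ck U 2 F ->
  (forall x, U x -> F x <= F x0) -> (forall x, U x -> 0 <= L F x) ->
  \forall x \near x0, F x = F x0.
Proof.
move=> Ux0 CF Fmax LF.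
have /nbhs_normP[r /= r0 Hr] := nearU oU Ux0.
have r2 : 0 < r / 2 by rewrite divr_gt0.
have n1 : \forall q \near x0, sqdist x0 q < (r / 2) ^+ 2.
  apply: (cvgr_lt _ (@sqdist_continuous R n x0 x0)).
  by rewrite /sqdist big1 ?exprn_gt0 // => i _; rewrite subrr expr0n.
have n2 : \forall q \near x0, `|x0 - q| < r / 2.
  by apply/nbhs_normP; exists (r / 2).
apply: filterS2 n1 n2 => q q1 q2.
(* Radius [r / 2] keeps the ball around [q] inside the ball of radius [r]
   around [x0]. *)
apply: (@annulus_comparison F q x0 ((r / 2) ^+ 2)) => //.
  move=> x /(sqdist_norm (ltW r2)) xq; apply: Hr => /=.
  rewrite -(subrK q x0) -addrA; apply: (le_lt_trans (ler_normD _ _)).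
  by rewrite distrC in xq; lra.
rewrite /sqdist in q1 *; congr (_ < _): q1; apply: eq_bigr => i _.
by rewrite -sqrrN opprB.
Qed.

End StrongMaximumPrinciple.

(** * Matrix-valued functions *)

Section MatrixFields.
Context {R : realType} {n : nat}.
Local Notation E := 'rV[R]_n.
Variable U : set E.
Hypothesis oU : open U.
Implicit Types (A B : E -> 'M[R]_n) (x : E) (k : nat) (i j m : 'I_n).

Definition mxCk k A := forall i j, Ck U k (fun x => A x i j).

Definition partial_mx m A x : 'M[R]_n := \matrix_(i, j) partial m (fun y => A y i j) x.

Lemma Ck_derivable k (f : E -> R) m x : Ck U k.+1 f -> U x ->
  derivable f x (delta_mx ord0 m).
Proof. by move=> [_ fd _]; exact: fd. Qed.
Arguments Ck_derivable {k f} m {x}.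

Lemma eq_mxCk k A B : (forall x, U x -> A x = B x) -> mxCk k A -> mxCk k B.
Proof. by move=> AB CA i j; apply: (eq_Ck oU) (CA i j) => x Ux; rewrite AB. Qed.

Lemma eq_partial_mx A B m x : (forall x, U x -> A x = B x) -> U x ->
  partial_mx m A x = partial_mx m B x.
Proof.
move=> AB Ux; apply/matrixP => i j; rewrite !mxE.
by apply: (eq_partial oU) Ux => y Uy; rewrite AB.
Qed.

Lemma mxCkW k A : mxCk k.+1 A -> mxCk k A.
Proof. by move=> CA i j; exact: CkW (CA i j). Qed.

Lemma mxCk_partial k m A : mxCk k.+1 A -> mxCk k (partial_mx m A).
Proof.
move=> CA i j; have [_ _ Cp] := CA i j.
by apply: (eq_Ck oU) (Cp m) => x Ux; rewrite mxE.
Qed.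

Lemma mxCkD k A B : mxCk k A -> mxCk k B -> mxCk k (fun x => A x + B x).
Proof.
move=> CA CB i j; apply: (eq_Ck oU) (CkD oU (CA i j) (CB i j)) => x _.
by rewrite mxE.
Qed.

Lemma mxCkN k A : mxCk k A -> mxCk k (fun x => - A x).
Proof.
move=> CA i j; apply: (eq_Ck oU) (CkN oU (CA i j)) => x _.
by rewrite mxE.
Qed.

Lemma mxCkM k A B : mxCk k A -> mxCk k B -> mxCk k (fun x => A x *m B x).
Proof.
move=> CA CB i j.
have C l := CkM oU (CA i l) (CB l j).
apply: (eq_Ck oU) (Ck_sum oU (index_enum _) C) => x _.
by rewrite mxE.
Qed.

Lemma mxCkT k A : mxCk k A -> mxCk k (fun x => (A x)^T).
Proof.
move=> CA i j; apply: (eq_Ck oU) (CA j i) => x _; by rewrite mxE.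
Qed.

Lemma mxtrace_Ck k A : mxCk k A -> Ck U k (fun x => \tr (A x)).
Proof. by move=> CA; exact: (Ck_sum oU (index_enum _) (fun i => CA i i)). Qed.

Lemma det_Ck k p (A : E -> 'M[R]_p) :
  (forall a c, Ck U k (fun x => A x a c)) -> Ck U k (fun x => \det (A x)).
Proof.
move=> CA.
have C (s : {perm 'I_p}) : Ck U k (fun x => (-1) ^+ s * \prod_a A x a (s a)).
  exact: (CkM oU (Ck_cst oU k _) (Ck_prod oU (index_enum _) (fun a => CA a (s a)))).
exact: (Ck_sum oU (index_enum _) C).
Qed.

Lemma invmx_Ck k A : (forall x, U x -> A x \in unitmx) -> mxCk k A ->
  mxCk k (fun x => invmx (A x)).
Proof.
move=> AU CA i j.
have det0 x : U x -> \det (A x) != 0.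
  by move=> /AU; rewrite unitmxE unitfE.
have Cdet : Ck U k (fun x => \det (A x)) by exact: det_Ck.
have Cminor : Ck U k (fun x => \det (row' j (col' i (A x)))).
  by apply: det_Ck => a b; apply: (eq_Ck oU) (CA (lift j a) (lift i b)) => x _; rewrite !mxE.
apply: (eq_Ck oU) (CkM oU (CkV oU det0 Cdet)
  (CkM oU (Ck_cst oU k ((-1) ^+ (j + i))) Cminor)) => x Ux.
by rewrite /invmx AU // !mxE.
Qed.

Lemma partial_mxD m A B x : mxCk 1 A -> mxCk 1 B -> U x ->
  partial_mx m (fun y => A y + B y) x = partial_mx m A x + partial_mx m B x.
Proof.
move=> CA CB Ux; apply/matrixP => i j; rewrite !mxE.
rewrite (_ : (fun y => (A y + B y) i j) = fun y => A y i j + B y i j); last first.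
  by apply/funext => y; rewrite mxE.
exact: (partialD (Ck_derivable m (CA i j) Ux) (Ck_derivable m (CB i j) Ux)).
Qed.

Lemma partial_mxT m A x : partial_mx m (fun y => (A y)^T) x = (partial_mx m A x)^T.
Proof.
apply/matrixP => i j; rewrite !mxE; congr (partial m _ x).
by apply/funext => y; rewrite mxE.
Qed.

Lemma partial_mxM m A B x : mxCk 1 A -> mxCk 1 B -> U x ->
  partial_mx m (fun y => A y *m B y) x =
  partial_mx m A x *m B x + A x *m partial_mx m B x.
Proof.
move=> CA CB Ux; apply/matrixP => i j; rewrite !mxE.
rewrite (_ : (fun y => (A y *m B y) i j) = fun y => \sum_l A y i l * B y l j); last first.
  by apply/funext => y; rewrite mxE.
have dA l := Ck_derivable m (CA i l) Ux.
have dB l := Ck_derivable m (CB l j) Ux.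
rewrite (partial_sum (fun l => derivableM (dA l) (dB l))) -big_split.
by apply: eq_bigr => l _; rewrite (partialM (dA l) (dB l)) !mxE.
Qed.

Lemma partial_mx_cst m (A : 'M[R]_n) x : partial_mx m (fun=> A) x = 0.
Proof. by apply/matrixP => i j; rewrite !mxE partial_cst. Qed.

Lemma partial_mxtrace m A x : mxCk 1 A -> U x ->
  partial m (fun y => \tr (A y)) x = \tr (partial_mx m A x).
Proof.
move=> CA Ux; rewrite (partial_sum (fun i => Ck_derivable m (CA i i) Ux)).
by apply: eq_bigr => i _; rewrite mxE.
Qed.

Lemma partial_mxC m l A x : mxCk 2 A -> U x ->
  partial_mx m (partial_mx l A) x = partial_mx l (partial_mx m A) x.
Proof.
move=> CA Ux; apply/matrixP => i j; rewrite [LHS]mxE [RHS]mxE.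
transitivity (partial m (partial l (fun y => A y i j)) x).
  by congr (partial m _ x); apply/funext => y; rewrite mxE.
rewrite (C2_partialC oU m l (CA i j) Ux).
by congr (partial l _ x); apply/funext => y; rewrite mxE.
Qed.

Lemma partial_invmx m A x : (forall x, U x -> A x \in unitmx) -> mxCk 1 A ->
  U x -> partial_mx m (fun y => invmx (A y)) x =
  - (invmx (A x) *m partial_mx m A x *m invmx (A x)).
Proof.
move=> AU CA Ux; have Ci := invmx_Ck AU CA.
have : partial_mx m (fun y => A y *m invmx (A y)) x = 0.
  rewrite -(partial_mx_cst m 1%:M x); apply: eq_partial_mx => // y Uy.
  by rewrite mulmxV // AU.
rewrite partial_mxM // => /eqP; rewrite addrC addr_eq0 => /eqP H.
by rewrite -[LHS](mulKmx (AU x Ux)) H mulmxN mulmxA.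
Qed.

End MatrixFields.
Arguments Ck_derivable {R n U k f} m {x}.

Lemma Ck_sub (R : realType) n (U V : set 'rV[R]_n) k f :
  V `<=` U -> Ck U k f -> Ck V k f.
Proof.
move=> VU; elim: k f => [|k IHk] f; first by move=> fc x /VU; exact: fc.
move=> [fc fd fp]; split; first by move=> x /VU; exact: fc.
  by move=> i x /VU; exact: fd.
by move=> i; apply: IHk; exact: fp.
Qed.

(** * The Levi-Civita connection in matrix form *)

Lemma posdefmx_unit (R : realType) n (A : 'M[R]_n) : A^T = A -> posdefmx A ->
  A \in unitmx.
Proof.
move=> Asym Apos.
have [B [_ [BAB _]]] := simultaneous_diagonalization Asym Apos (trmx1 _ _).
by have [] := frame_invmx BAB.
Qed.

Section LocalGeometry.
Context {R : realType} {n : nat}.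
Local Notation E := 'rV[R]_n.
Variable U : set E.
Hypothesis oU : open U.
Variable g : E -> 'M[R]_n.
Hypothesis Cg : forall k, mxCk U k g.
Hypothesis gsym : forall x, U x -> (g x)^T = g x.
Hypothesis gpos : forall x, U x -> posdefmx (g x).
Implicit Types (x : E) (i j k l m : 'I_n) (A : E -> 'M[R]_n).

Lemma g_unit x : U x -> g x \in unitmx.
Proof. by move=> Ux; apply: posdefmx_unit; [exact: gsym | exact: gpos]. Qed.

Definition cometric x := invmx (g x).

Lemma cometric_Ck d : mxCk U d cometric.
Proof. by apply: (invmx_Ck oU); [exact: g_unit | exact: Cg]. Qed.

Lemma cometric_sym x : U x -> (cometric x)^T = cometric x.
Proof. by move=> Ux; rewrite /cometric trmx_inv gsym. Qed.

(** The matrix of the connection form along the [m]-th coordinate, transposed so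
    that the covariant derivative of a covariant 2-tensor [A] reads
    [d_m A - C_m A - A C_m^T]; tensor identities become matrix identities. *)
Definition connection_mx m x : 'M[R]_n := \matrix_(k, l) christoffel g l m k x.

(** Twice the Christoffel symbols of the first kind. *)
Definition first_kind_mx m x : 'M[R]_n := \matrix_(k, q)
  (partial m (fun y => g y k q) x + partial k (fun y => g y m q) x
   - partial q (fun y => g y m k) x).

Lemma first_kind_Ck d m : mxCk U d (first_kind_mx m).
Proof.
move=> i j.
have C a b c : Ck U d (partial a (fun y => g y b c)) by have [_ _] := @Cg d.+1 b c; exact.
have := CkB oU (CkD oU (C m i j) (C i m j)) (C j m i).
by apply: (eq_Ck oU) => x _; rewrite mxE.
Qed.

Lemma connection_mxE m x : U x ->
  connection_mx m x = 2^-1 *: (first_kind_mx m x *m cometric x).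
Proof.
move=> Ux; apply/matrixP => k l; rewrite mxE [RHS]mxE /christoffel; congr (_ * _).
rewrite [RHS]mxE; apply: eq_bigr => q _.
have /matrixP/(_ q l) := cometric_sym Ux; rewrite mxE => <-.
by rewrite [first_kind_mx _ _ _ _]mxE mulrC.
Qed.

Lemma connection_Ck d m : mxCk U d (connection_mx m).
Proof.
move=> i j; have C := mxCkM oU (@first_kind_Ck d m) (@cometric_Ck d) i j.
apply: (eq_Ck oU) (CkM oU (Ck_cst oU d 2^-1) C) => x Ux.
by rewrite connection_mxE // [RHS]mxE.
Qed.

Lemma metric_compatible m x : U x ->
  partial_mx m g x = connection_mx m x *m g x + g x *m (connection_mx m x)^T.
Proof.
move=> Ux; have gU := g_unit Ux.
rewrite connection_mxE // linearZ /= trmx_mul cometric_sym // -scalemxAl -scalemxAr.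
rewrite mulmxKV // mulKVmx // -scalerDr.
have pC a b c : partial a (fun y => g y b c) x = partial a (fun y => g y c b) x.
  apply: (eq_partial oU) => // y Uy.
  by rewrite -[in LHS](gsym Uy) mxE.
apply/matrixP => i j; rewrite !mxE (pC j m i) (pC i m j) (pC m j i).
move: (partial _ _ _) (partial _ _ _) (partial _ _ _) => p1 p2 p3.
by field.
Qed.

Definition cov_mx A k x : 'M[R]_n := \matrix_(i, j) cov_deriv2 g A k i j x.

Lemma cov_mxE A k x : cov_mx A k x =
  partial_mx k A x - connection_mx k x *m A x - A x *m (connection_mx k x)^T.
Proof.
apply/matrixP => i j; rewrite !mxE /cov_deriv2 big_split opprD addrA.
congr (_ - _ - _); apply: eq_bigr => l _; rewrite !mxE //.
by rewrite mulrC.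
Qed.

Definition cov2_mx A m k x : 'M[R]_n :=
  \matrix_(i, j) cov_deriv3 g (cov_deriv2 g A) m k i j x.

Lemma cov2_mxE A m k x : cov2_mx A m k x =
  partial_mx m (cov_mx A k) x - \sum_l christoffel g l m k x *: cov_mx A l x
  - connection_mx m x *m cov_mx A k x - cov_mx A k x *m (connection_mx m x)^T.
Proof.
apply/matrixP => i j; rewrite [LHS]mxE /cov_deriv3.
have -> : (partial_mx m (cov_mx A k) x
    - \sum_l christoffel g l m k x *: cov_mx A l x
    - connection_mx m x *m cov_mx A k x
    - cov_mx A k x *m (connection_mx m x)^T) i j =
  partial_mx m (cov_mx A k) x i j
   - (\sum_l christoffel g l m k x *: cov_mx A l x) i j
   - (connection_mx m x *m cov_mx A k x) i j
   - (cov_mx A k x *m (connection_mx m x)^T) i j.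
  by move: (partial_mx _ _ _) (\sum_l _) (_ *m _) (_ *m _) => X Y Z W; rewrite !mxE.
rewrite !big_split !opprD !addrA; congr (_ - _ - _ - _).
- rewrite mxE; congr (partial m _ x).
  by apply/funext => y; rewrite mxE.
- by rewrite summxE; apply: eq_bigr => l _; rewrite !mxE.
- by rewrite mxE; apply: eq_bigr => l _; rewrite !mxE.
- by rewrite mxE; apply: eq_bigr => l _; rewrite !mxE mulrC.
Qed.

Lemma cov_mx_Ck d A l : mxCk U d.+1 A -> mxCk U d (cov_mx A l).
Proof.
move=> CA; have CA' := mxCkW CA.
have Cc := @connection_Ck d l.
have C1 := mxCkN oU (mxCkM oU Cc CA').
have C2 := mxCkN oU (mxCkM oU CA' (mxCkT oU Cc)).
have C := mxCkD oU (mxCkD oU (mxCk_partial oU l CA) C1) C2.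
by apply: (eq_mxCk oU) C => x _; rewrite cov_mxE.
Qed.

Lemma cov_mx_sym A k x : (forall y, U y -> (A y)^T = A y) -> U x ->
  (cov_mx A k x)^T = cov_mx A k x.
Proof.
move=> Asym Ux; rewrite cov_mxE !linearB /= !trmx_mul trmxK Asym //.
rewrite -partial_mxT (eq_partial_mx oU k Asym Ux).
by rewrite addrAC.
Qed.

Lemma cometric_partial m x : U x -> partial_mx m cometric x =
  - (cometric x *m connection_mx m x) - (connection_mx m x)^T *m cometric x.
Proof.
move=> Ux; have gU := g_unit Ux.
rewrite (partial_invmx oU m (@g_unit) (@Cg 1) Ux) metric_compatible //.
rewrite mulmxDr mulmxDl -opprD; congr (- (_ + _)).
  by rewrite !mulmxA mulmxK.
by rewrite !mulmxA mulVmx // mul1mx.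
Qed.

(** For the endomorphism [h A] obtained by raising an index, the ordinary and the
    covariant derivative differ by a commutator with [C_m^T].  Such commutators
    cancel inside traces, which is why the next computations need no derivative
    of the inverse metric. *)
Lemma partial_raise A m x : mxCk U 1 A -> U x ->
  partial_mx m (fun y => cometric y *m A y) x =
  cometric x *m (partial_mx m A x - connection_mx m x *m A x
                 - A x *m (connection_mx m x)^T)
  + (cometric x *m A x *m (connection_mx m x)^T
     - (connection_mx m x)^T *m (cometric x *m A x)).
Proof.
move=> CA Ux; rewrite (partial_mxM m (@cometric_Ck 1) CA Ux) cometric_partial //.
move: (connection_mx m x) (cometric x) (A x) (partial_mx m A x) => C h X dX.
rewrite !mulmxBr mulmxBl mulNmx !mulmxA.
move: (h *m C *m X) (C^T *m h *m X) (h *m dX) (h *m X *m C^T) => a b c d.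
by rewrite [RHS]addrA subrK [LHS]addrC [LHS]addrA.
Qed.

End LocalGeometry.

(** * The Laplacian of the squared norm of a tensor field *)

Lemma trace_commutator (R : comNzRingType) n (P Q K : 'M[R]_n) :
  \tr ((Q + (P *m K - K *m P)) *m P) + \tr (P *m (Q + (P *m K - K *m P)))
  = 2 * \tr (Q *m P).
Proof.
set X := Q + _; rewrite [\tr (P *m X)]mxtrace_mulC.
have -> : \tr (X *m P) = \tr (Q *m P).
  rewrite mulmxDl mulmxBl !linearD linearN /= -[P *m K *m P]mulmxA.
  by rewrite [\tr (P *m (K *m P))]mxtrace_mulC subrr addr0.
by ring.
Qed.

Lemma trace_commutator2 (R : comNzRingType) n (P P' Q Q' K : 'M[R]_n) :
  \tr ((Q' + (Q *m K - K *m Q)) *m P) + \tr (Q *m (P' + (P *m K - K *m P)))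
  = \tr (Q' *m P) + \tr (Q *m P').
Proof.
rewrite mulmxDl mulmxDr mulmxBl mulmxBr !mxtraceD !raddfN /=.
have -> : \tr (K *m Q *m P) = \tr (Q *m P *m K) by rewrite -mulmxA mxtrace_mulC.
rewrite !mulmxA.
move: (\tr (Q' *m P)) (\tr (Q *m P')) (\tr (Q *m K *m P)) (\tr (Q *m P *m K)).
by move=> a b c d; ring.
Qed.

Section Bochner.
Context {R : realType} {n : nat}.
Local Notation E := 'rV[R]_n.
Variable U : set E.
Hypothesis oU : open U.
Variables g phi : E -> 'M[R]_n.
Hypothesis Cg : forall k, mxCk U k g.
Hypothesis gsym : forall x, U x -> (g x)^T = g x.
Hypothesis gpos : forall x, U x -> posdefmx (g x).
Hypothesis Cphi : forall k, mxCk U k phi.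
Implicit Types (x : E) (i j k l m : 'I_n).
Local Notation h := (cometric g).
Local Notation T := (cov_mx g phi).

Definition norm_sq x : R := \tr (h x *m phi x *m (h x *m phi x)).

Lemma norm_sq_Ck d : Ck U d norm_sq.
Proof.
have Ch := @cometric_Ck R n U oU g Cg gsym gpos d.
have CP := mxCkM oU Ch (Cphi d).
exact: (mxtrace_Ck oU (mxCkM oU CP CP)).
Qed.

Lemma partial_norm_sq m x : U x ->
  partial m norm_sq x = 2 * \tr (h x *m T m x *m (h x *m phi x)).
Proof.
move=> Ux; have Ch := @cometric_Ck R n U oU g Cg gsym gpos 1.
have CP := mxCkM oU Ch (@Cphi 1).
rewrite (partial_mxtrace m (mxCkM oU CP CP) Ux) (partial_mxM m CP CP Ux).
have dP := partial_raise oU Cg gsym gpos m (@Cphi 1) Ux.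
by rewrite dP -cov_mxE linearD trace_commutator.
Qed.

Lemma partial2_norm_sq m k x : U x ->
  partial m (partial k norm_sq) x =
  2 * \tr (h x *m cov2_mx g phi m k x *m (h x *m phi x))
  + 2 * \tr (h x *m T k x *m (h x *m T m x))
  + \sum_l christoffel g l m k x * partial l norm_sq x.
Proof.
move=> Ux; have Ch := @cometric_Ck R n U oU g Cg gsym gpos 1.
have CP := mxCkM oU Ch (@Cphi 1).
have CT : mxCk U 1 (T k) by apply: (cov_mx_Ck oU Cg gsym gpos); exact: Cphi.
have CQ := mxCkM oU Ch CT.
rewrite (eq_partial oU (@partial_norm_sq k)) //.
have [_ d2 _] := Ck_cst oU 1 (2 : R).
rewrite (partialM (d2 m x Ux) (Ck_derivable m (mxtrace_Ck oU (mxCkM oU CQ CP)) Ux)).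
rewrite partial_cst mul0r add0r.
rewrite (partial_mxtrace m (mxCkM oU CQ CP) Ux) (partial_mxM m CQ CP Ux).
have dP := partial_raise oU Cg gsym gpos m (@Cphi 1) Ux.
have dQ := partial_raise oU Cg gsym gpos m CT Ux.
rewrite dP dQ -(cov_mxE g phi m x) linearD trace_commutator2.
have -> : partial_mx m (T k) x - connection_mx g m x *m T k x
     - T k x *m (connection_mx g m x)^T
   = cov2_mx g phi m k x + \sum_l christoffel g l m k x *: T l x.
  rewrite cov2_mxE; move: (partial_mx _ _ _) (\sum_l _) (_ *m _) (_ *m _).
  by move=> X Y Z W; rewrite [RHS]addrAC [X - Y - W + Y]addrAC subrK.
have -> : \sum_l christoffel g l m k x * partial l norm_sq x = 2 *
    \tr (h x *m (\sum_l christoffel g l m k x *: T l x) *m (h x *m phi x)).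
  rewrite mulmx_sumr mulmx_suml raddf_sum /= mulr_sumr; apply: eq_bigr => l _.
  rewrite partial_norm_sq // -scalemxAr -scalemxAl mxtraceZ.
  by rewrite mulrCA.
rewrite [h x *m (_ + _)]mulmxDr mulmxDl mxtraceD.
by move: (\tr _) (\tr _) (\tr _) => a b c; ring.
Qed.

(** The first-order coefficients [- h^mk Gamma^l_mk] of the Laplace-Beltrami
    operator. *)
Definition drift x l : R := - \sum_m \sum_k h x m k * christoffel g l m k x.

(** The squared norm of the covariant derivative of [phi]. *)
Definition energy x : R :=
  \sum_m \sum_k h x m k * \tr (h x *m T k x *m (h x *m T m x)).

Lemma elliptic_norm_sq x : U x ->
  elliptic_op h drift norm_sq x =
  - 2 * \tr (h x *m (\matrix_(i, j) rough_laplacian g phi i j x) *m (h x *m phi x))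
  + 2 * energy x.
Proof.
move=> Ux; rewrite /elliptic_op.
have -> : \sum_l drift x l * partial l norm_sq x =
  - \sum_m \sum_k h x m k * \sum_l christoffel g l m k x * partial l norm_sq x.
  under eq_bigr => l _ do rewrite /drift mulNr.
  rewrite sumrN; congr (- _).
  under eq_bigr => l _ do rewrite mulr_suml.
  rewrite exchange_big; apply: eq_bigr => m _.
  under eq_bigr => l _ do rewrite mulr_suml.
  rewrite exchange_big; apply: eq_bigr => k _.
  by rewrite mulr_sumr; apply: eq_bigr => l _; rewrite [RHS]mulrA.
rewrite -sumrB.
have -> : (\matrix_(i, j) rough_laplacian g phi i j x) =
  - \sum_m \sum_k h x m k *: cov2_mx g phi m k x.
  apply/matrixP => i j; rewrite [LHS]mxE [RHS]mxE; congr (- _).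
  rewrite summxE; apply: eq_bigr => m _; rewrite summxE; apply: eq_bigr => k _.
  by rewrite [RHS]mxE [cov2_mx _ _ _ _ _ _ _]mxE.
rewrite mulmxN mulNmx linearN /= mulrNN.
rewrite mulmx_sumr mulmx_suml linear_sum /= /energy.
rewrite [X in _ = X + _]mulr_sumr [X in _ = _ + X]mulr_sumr -big_split /=.
apply: eq_bigr => m _.
rewrite -sumrB mulmx_sumr mulmx_suml linear_sum /=.
rewrite [X in _ = X + _]mulr_sumr [X in _ = _ + X]mulr_sumr -big_split /=.
apply: eq_bigr => k _.
rewrite partial2_norm_sq // -scalemxAr -scalemxAl mxtraceZ.
move: (\tr _) (\tr _) (\sum_l _) (h x m k) => a b c d; ring.
Qed.

End Bochner.

(** * Positivity of the energy and curvature identities *)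

Section Positivity.
Context {R : realType} {n : nat}.
Implicit Types (B g X : 'M[R]_n) (T : 'I_n -> 'M[R]_n).

(** In an orthonormal frame the squared norm of a symmetric tensor is the sum of
    the squares of its components. *)
Lemma trace_sq_frame B X : X^T = X ->
  \tr (B^T *m B *m X *m (B^T *m B *m X)) =
  \sum_i \sum_j ((B *m X *m B^T) i j) ^+ 2.
Proof.
move=> Xsym; set S := B *m X *m B^T.
have Ssym : S^T = S by rewrite /S !trmx_mul trmxK Xsym mulmxA.
transitivity (\tr (S *m S)).
  by rewrite /S -!mulmxA mxtrace_mulC !mulmxA.
apply: eq_bigr => i _; rewrite mxE; apply: eq_bigr => j _.
have /matrixP/(_ i j) := Ssym; rewrite mxE => ->.
by rewrite expr2.
Qed.

Lemma trace_sq_ge0 g X : g^T = g -> posdefmx g -> X^T = X ->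
  0 <= \tr (invmx g *m X *m (invmx g *m X)).
Proof.
move=> gsym gpos Xsym.
have [B [_ [BgB _]]] := simultaneous_diagonalization gsym gpos Xsym.
have [_ _ ->] := frame_invmx BgB; rewrite trace_sq_frame //.
by apply: sumr_ge0 => i _; apply: sumr_ge0 => j _; exact: sqr_ge0.
Qed.

Lemma trace_sq_eq0 g X : g^T = g -> posdefmx g -> X^T = X ->
  \tr (invmx g *m X *m (invmx g *m X)) = 0 -> X = 0.
Proof.
move=> gsym gpos Xsym.
have [B [_ [BgB _]]] := simultaneous_diagonalization gsym gpos Xsym.
have [_ BU ->] := frame_invmx BgB; rewrite trace_sq_frame //.
move=> /eqP; rewrite psumr_eq0 => [/allP H|i _]; last first.
  by apply: sumr_ge0 => j _; exact: sqr_ge0.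
have S0 : B *m X *m B^T = 0.
  apply/matrixP => i j; have /= := H i (mem_index_enum _).
  rewrite psumr_eq0 => [/allP /(_ j (mem_index_enum _))|k _]; last exact: sqr_ge0.
  by rewrite /= sqrf_eq0 [RHS]mxE => /eqP.
have BTU : B^T \in unitmx by rewrite unitmx_tr.
have BX : B *m X = 0 by rewrite -[LHS](mulmxK BTU) S0 mul0mx.
by rewrite -[LHS](mulKmx BU) BX mulmx0.
Qed.

(** Expanding the derivative index in the frame [B] writes the energy as a sum of
    squared norms of symmetric tensors. *)
Lemma energy_frame B T (h := B^T *m B) :
  \sum_m \sum_k h m k * \tr (h *m T k *m (h *m T m)) =
  \sum_a \tr (h *m (\sum_k B a k *: T k) *m (h *m (\sum_k B a k *: T k))).
Proof.
pose M := \matrix_(m, k) \tr (h *m T k *m (h *m T m)).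
transitivity (\sum_m \sum_k M m k * h m k).
  by apply: eq_bigr => m _; apply: eq_bigr => k _; rewrite [M _ _]mxE mulrC.
rewrite sum_gram; apply: eq_bigr => a _.
rewrite [h *m (\sum_k _)]mulmx_sumr mulmx_sumr raddf_sum /=.
apply: eq_bigr => m _; rewrite mulmx_suml raddf_sum /=.
apply: eq_bigr => k _; rewrite -!scalemxAr -scalemxAl !mxtraceZ [M _ _]mxE.
by ring.
Qed.

Lemma energy_ge0 g T : g^T = g -> posdefmx g -> (forall k, (T k)^T = T k) ->
  0 <= \sum_m \sum_k invmx g m k * \tr (invmx g *m T k *m (invmx g *m T m)).
Proof.
move=> gsym gpos Tsym.
have [B [_ [BgB _]]] := simultaneous_diagonalization gsym gpos gsym.
have [_ _ hB] := frame_invmx BgB; rewrite hB energy_frame -hB.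
apply: sumr_ge0 => a _; apply: trace_sq_ge0 => //.
by rewrite linear_sum; apply: eq_bigr => k _; rewrite linearZ /= Tsym.
Qed.

Lemma energy_eq0 g T : g^T = g -> posdefmx g -> (forall k, (T k)^T = T k) ->
  \sum_m \sum_k invmx g m k * \tr (invmx g *m T k *m (invmx g *m T m)) = 0 ->
  forall k, T k = 0.
Proof.
move=> gsym gpos Tsym.
have [B [_ [BgB _]]] := simultaneous_diagonalization gsym gpos gsym.
have [_ BU hB] := frame_invmx BgB; rewrite hB energy_frame -hB => /eqP.
have Ssym a : (\sum_k B a k *: T k)^T = \sum_k B a k *: T k.
  by rewrite linear_sum; apply: eq_bigr => k _; rewrite linearZ /= Tsym.
rewrite psumr_eq0 => [/allP H k|a _]; last exact: trace_sq_ge0.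
have S0 a : \sum_k B a k *: T k = 0.
  by apply: (trace_sq_eq0 gsym gpos) => //; apply/eqP; exact: H (mem_index_enum _).
transitivity (\sum_a invmx B k a *: (\sum_l B a l *: T l)); last first.
  by rewrite big1 // => a _; rewrite S0 scaler0.
under eq_bigr => a _ do rewrite scaler_sumr.
rewrite exchange_big /=.
transitivity (\sum_l ((1%:M : 'M[R]_n) k l) *: T l).
  rewrite (bigD1 k) //= big1 ?addr0 => [|l lk]; rewrite mxE ?eqxx ?scale1r //.
  by rewrite eq_sym (negbTE lk) scale0r.
apply: eq_bigr => l _; rewrite -(mulVmx BU) mxE scaler_suml.
by apply: eq_bigr => a _; rewrite scalerA.
Qed.

End Positivity.

(** The two sides of the hypothesis are [d_m d_k X] and [d_k d_m X] for a
    solution of [d_m X = P X + X P^T], [d_k X = Q X + X Q^T]; the mixed terms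
    cancel and the curvature of the connection remains. *)
Lemma parallel_commutator (R : comNzRingType) n (P Q dP dQ X : 'M[R]_n) :
  dQ *m X + Q *m (P *m X + X *m P^T) + ((P *m X + X *m P^T) *m Q^T + X *m dQ^T)
  = dP *m X + P *m (Q *m X + X *m Q^T) + ((Q *m X + X *m Q^T) *m P^T + X *m dP^T)
  -> (dQ - dP + Q *m P - P *m Q) *m X + X *m (dQ - dP + Q *m P - P *m Q)^T = 0.
Proof.
have -> : (dQ - dP + Q *m P - P *m Q)^T = dQ^T - dP^T + P^T *m Q^T - Q^T *m P^T.
  rewrite -!trmx_mul; move: (Q *m P) (P *m Q) => a b.
  by apply/matrixP => i j; rewrite !mxE.
rewrite !(mulmxDl, mulmxDr, mulNmx, mulmxN) !mulmxA.
move: (dQ *m X) (dP *m X) (X *m dQ^T) (X *m dP^T).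
move: (Q *m P *m X) (P *m Q *m X) (Q *m X *m P^T) (P *m X *m Q^T).
move: (X *m P^T *m Q^T) (X *m Q^T *m P^T).
move=> y1 y2 y3 y4 y5 y6 y7 y8 y9 y10 /matrixP H; apply/matrixP => i j.
have := H i j; rewrite !mxE => /eqP; rewrite -subr_eq0 => /eqP <-.
by ring.
Qed.

Section CurvatureIdentities.
Context {R : realType} {n : nat}.
Local Notation E := 'rV[R]_n.
Variable U : set E.
Hypothesis oU : open U.
Variables g : E -> 'M[R]_n.
Hypothesis Cg : forall d, mxCk U d g.
Hypothesis gsym : forall x, U x -> (g x)^T = g x.
Hypothesis gpos : forall x, U x -> posdefmx (g x).
Implicit Types (x : E) (i j k l m : 'I_n) (A : E -> 'M[R]_n).
Local Notation C := (connection_mx g).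

Definition curvature_mx m k x : 'M[R]_n := \matrix_(i, j) curvature13 g j i m k x.

Lemma curvature_mxE m k x : curvature_mx m k x =
  partial_mx m (C k) x - partial_mx k (C m) x + C k x *m C m x - C m x *m C k x.
Proof.
have pE a b i j : partial_mx a (C b) x i j = partial a (christoffel g j b i) x.
  by rewrite mxE; congr (partial a _ x); apply/funext => y; rewrite mxE.
have sE (X Y Z W : 'M[R]_n) i j : (X - Y + Z - W) i j = X i j - Y i j + Z i j - W i j.
  by rewrite !mxE.
apply/matrixP => i j.
have L : curvature_mx m k x i j = curvature13 g j i m k x.
  by rewrite mxE.
have CE a b : (C a x *m C b x) i j =
    \sum_p christoffel g p a i x * christoffel g j b p x.
  by rewrite mxE; apply: eq_bigr => p _; rewrite !mxE.
rewrite L /curvature13 -(pE m k i j) -(pE k m i j) sE (CE k m) (CE m k).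
rewrite -[RHS]addrA -sumrB; congr (_ + _); apply: eq_bigr => p _.
by rewrite [in RHS]mulrC [X in _ = _ - X]mulrC.
Qed.

(** Ricci identity for a parallel field: its second derivatives, computed from
    [d_k A = C_k A + A C_k^T], are symmetric.  Applied to the metric itself it
    yields the antisymmetry of the curvature in its first two indices. *)
Lemma parallel_curvature A m k x : mxCk U 2 A ->
  (forall y l, U y -> partial_mx l A y = C l y *m A y + A y *m (C l y)^T) ->
  U x -> curvature_mx m k x *m A x + A x *m (curvature_mx m k x)^T = 0.
Proof.
move=> CA Apar Ux; have CA1 := mxCkW CA.
have CC l : mxCk U 1 (C l) by exact: (connection_Ck oU Cg gsym gpos).
have second a b : partial_mx a (partial_mx b A) x =
    partial_mx a (C b) x *m A x + C b x *m (C a x *m A x + A x *m (C a x)^T)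
    + ((C a x *m A x + A x *m (C a x)^T) *m (C b x)^T
       + A x *m (partial_mx a (C b) x)^T).
  rewrite (eq_partial_mx oU a (fun y => @Apar y b) Ux).
  rewrite (partial_mxD a (mxCkM oU (CC b) CA1) (mxCkM oU CA1 (mxCkT oU (CC b))) Ux).
  rewrite (partial_mxM a (CC b) CA1 Ux) (partial_mxM a CA1 (mxCkT oU (CC b)) Ux).
  by rewrite partial_mxT Apar.
have := partial_mxC oU m k CA Ux; rewrite !second curvature_mxE.
exact: parallel_commutator.
Qed.

Lemma curvature04_mx m k x i j : U x ->
  (curvature_mx m k x *m g x) i j = curvature04 g j i m k x.
Proof.
move=> Ux; rewrite mxE; apply: eq_bigr => q _; rewrite [curvature_mx _ _ _ _ _]mxE.
by rewrite -[in g x q j](gsym Ux) mxE mulrC.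
Qed.

Lemma curvature04_anti12 i j k l x : U x ->
  curvature04 g i j k l x = - curvature04 g j i k l x.
Proof.
move=> Ux.
have /matrixP/(_ j i) := @parallel_curvature g k l x (@Cg 2)
  (fun y l Uy => metric_compatible oU gsym gpos l Uy) Ux.
rewrite -[X in (_ + X *m _) j i](gsym Ux) -trmx_mul [RHS]mxE [LHS]mxE.
rewrite [(_ ^T) j i]mxE !curvature04_mx // => /eqP.
by rewrite addr_eq0 => /eqP.
Qed.

Lemma curvature13_anti34 i k j l x : curvature13 g i k j l x = - curvature13 g i k l j x.
Proof.
rewrite /curvature13 opprD opprB; congr (_ + _).
by rewrite -sumrN; apply: eq_bigr => p _; rewrite opprB.
Qed.

Lemma curvature04_anti34 i j k l x :
  curvature04 g i j k l x = - curvature04 g i j l k x.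
Proof.
rewrite /curvature04 -sumrN; apply: eq_bigr => q _.
by rewrite curvature13_anti34 mulrN.
Qed.

Lemma ricci_curvature04 k l x : U x ->
  \sum_i \sum_q invmx (g x) i q * curvature04 g q k i l x = ricci g k l x.
Proof.
move=> Ux; apply: eq_bigr => i _.
transitivity (\sum_m (invmx (g x) *m g x) i m * curvature13 g m k i l x).
  under [RHS]eq_bigr => m _ do rewrite mxE mulr_suml.
  rewrite exchange_big; apply: eq_bigr => q _; rewrite mulr_sumr.
  by apply: eq_bigr => m _; rewrite mulrA.
rewrite mulVmx ?(g_unit gsym gpos) // (bigD1 i) //= big1 ?addr0 => [|m mi].
  by rewrite mxE eqxx mul1r.
by rewrite mxE eq_sym (negbTE mi) mul0r.
Qed.

Lemma raise2E A k l x : U x ->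
  raise2 g A k l x = (invmx (g x) *m A x *m invmx (g x)) k l.
Proof.
move=> Ux; rewrite mulmx3E; apply: eq_bigr => i _; apply: eq_bigr => j _.
have /matrixP/(_ l j) := cometric_sym gsym Ux.
by rewrite mxE /cometric => <-; rewrite mulrAC.
Qed.

Variable kappa : R.
Hypothesis einstein : forall x, U x -> forall i j, ricci g i j x = kappa * g x i j.

(** Contracting the Ricci identity of a parallel tensor with the inverse metric
    turns one curvature term into the curvature operator and the other one into
    the Ricci tensor, that is [kappa A]. *)
Lemma parallel_curvature_operator A x : mxCk U 2 A ->
  (forall y l, U y -> cov_mx g A l y = 0) -> U x -> forall i k,
  curvature_operator2 g A i k x = kappa * A x i k.
Proof.
move=> CA Apar Ux i k; have gU := g_unit gsym gpos Ux.
set h := invmx (g x); pose Rm m := curvature_mx m k x *m g x.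
have RmE m a b : Rm m a b = curvature04 g b a m k x by exact: curvature04_mx.
have RmT m : (Rm m)^T = - Rm m.
  by apply/matrixP => a b; rewrite [LHS]mxE [RHS]mxE (RmE m b a) (RmE m a b) curvature04_anti12.
have Apar' y l : U y -> partial_mx l A y = C l y *m A y + A y *m (C l y)^T.
  move=> Uy; have := Apar y l Uy; rewrite cov_mxE => /eqP.
  by rewrite subr_eq add0r subr_eq addrC => /eqP.
(* The Ricci identity says that the skew forms [Rm m] are intertwined by [A];
   multiplying by [h] and summing over [m] contracts both sides. *)
have comm m : Rm m *m h *m A x = A x *m h *m Rm m.
  have := @parallel_curvature A m k x CA Apar' Ux.
  have -> : curvature_mx m k x = Rm m *m h by rewrite /Rm mulmxK.
  have hT : h^T = h by exact: (cometric_sym gsym Ux).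
  rewrite trmx_mul RmT hT !mulmxN mulmxA => /eqP.
  by rewrite subr_eq0 => /eqP.
transitivity (\sum_m (Rm m *m (h *m A x *m h)) i m).
  rewrite /curvature_operator2 exchange_big; apply: eq_bigr => m _.
  rewrite mxE; apply: eq_bigr => q _; rewrite raise2E // RmE.
  by rewrite curvature04_anti12 // curvature04_anti34 opprK.
transitivity (\sum_m \sum_a (A x *m h) i a * (Rm m *m h) a m).
  by apply: eq_bigr => m _; rewrite !mulmxA comm -mulmxA mxE.
rewrite exchange_big /=.
transitivity (\sum_a (A x *m h) i a * (kappa * g x a k)).
  apply: eq_bigr => a _; rewrite -mulr_sumr -einstein // -ricci_curvature04 //.
  congr (_ * _); apply: eq_bigr => m _; rewrite mxE; apply: eq_bigr => q _.
  rewrite RmE mulrC; congr (_ * _).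
  have /matrixP/(_ m q) := cometric_sym gsym Ux.
  by rewrite mxE.
transitivity (kappa * (A x *m h *m g x) i k); last by rewrite mulmxKV.
rewrite mxE mulr_sumr; apply: eq_bigr => a _; by rewrite mulrCA.
Qed.

End CurvatureIdentities.

(** * Rigidity in a chart *)

Section LocalRigidity.
Context {R : realType} {n : nat}.
Local Notation E := 'rV[R]_n.
Variable U : set E.
Hypothesis oU : open U.
Variables g phi : E -> 'M[R]_n.
Hypothesis Cg : forall d, mxCk U d g.
Hypothesis gsym : forall x, U x -> (g x)^T = g x.
Hypothesis gpos : forall x, U x -> posdefmx (g x).
Hypothesis Cphi : forall d, mxCk U d phi.
Hypothesis phisym : forall x, U x -> (phi x)^T = phi x.
Variables kappa Kmin lambda : R.
Hypothesis einstein : forall x, U x -> forall i j, ricci g i j x = kappa * g x i j.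
Hypothesis KminP : forall x u v, U x -> orthonormal_pair g x u v -> Kmin <= sec g x u v.
Hypothesis kappa_gt0 : 0 < kappa.
Hypothesis kappa_le : kappa <= n%:R * Kmin.
Hypothesis tr_phi : forall x, U x -> trace2 g phi x = 0.
Hypothesis eigen : forall x, U x -> forall i j,
  einstein_operator g phi i j x = lambda * phi x i j.
Hypothesis lambda_le0 : lambda <= 0.
Local Notation F := (norm_sq g phi).
Local Notation Rphi x := (\matrix_(i, j) curvature_operator2 g phi i j x).
Local Notation h := (cometric g).
Local Notation Q x := (\tr (h x *m Rphi x *m (h x *m phi x))).

Lemma norm_sq_ge0 x : U x -> 0 <= F x.
Proof.
by move=> Ux; apply: trace_sq_ge0; [exact: gsym | exact: gpos | exact: phisym].
Qed.

Lemma curvature_term_le0 x : U x -> Q x <= 0.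
Proof.
move=> Ux; have gs := gsym Ux; have gp := gpos Ux; have hs := cometric_sym gsym Ux.
have Ps : (h x *m phi x *m h x)^T = h x *m phi x *m h x.
  by rewrite !trmx_mul hs phisym // mulmxA.
have -> : Q x = \sum_i \sum_j (\sum_k \sum_l curvature04 g i k j l x *
    (h x *m phi x *m h x) k l) * (h x *m phi x *m h x) i j.
  have -> : Q x = \tr (Rphi x *m (h x *m phi x *m h x)).
    by rewrite -mulmxA mxtrace_mulC !mulmxA.
  apply: eq_bigr => i _; rewrite mxE; apply: eq_bigr => j _.
  have /matrixP/(_ i j) := Ps; rewrite mxE => ->; congr (_ * _).
  rewrite mxE; apply: eq_bigr => k _; apply: eq_bigr => l _.
  by rewrite (raise2E gsym).
have KP u v : (u *m g x *m u^T) ord0 ord0 = 1 -> (v *m g x *m v^T) ord0 ord0 = 1 ->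
    (u *m g x *m v^T) ord0 ord0 = 0 ->
    Kmin <= sec_form (fun i j k l => curvature04 g i j k l x) u v.
  by move=> uu vv uv; apply: (KminP Ux).
have ein k l : \sum_i \sum_q invmx (g x) i q * curvature04 g q k i l x = kappa * g x k l.
  by rewrite (ricci_curvature04 gsym gpos) // einstein.
have tr0 : \tr (invmx (g x) *m phi x) = 0.
  rewrite -(tr_phi Ux); apply: eq_bigr => i _; rewrite mxE; apply: eq_bigr => j _.
  by rewrite -[in LHS](phisym Ux) mxE.
have a12 i j k l : curvature04 g i j k l x = - curvature04 g j i k l x.
  exact: (curvature04_anti12 oU Cg gsym gpos).
have a34 i j k l : curvature04 g i j k l x = - curvature04 g i j l k x.
  exact: curvature04_anti34.
have := curvature_pairing_le a12 a34 gs ein KP gp (phisym Ux) tr0.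
move=> /le_trans; apply; rewrite mulr_le0_ge0 ?subr_le0 //.
exact: norm_sq_ge0.
Qed.

Lemma cov_phi_sym x : U x -> forall k, (cov_mx g phi k x)^T = cov_mx g phi k x.
Proof. by move=> Ux k; apply: (cov_mx_sym oU g k phisym Ux). Qed.

Lemma bochner x : U x ->
  elliptic_op h (drift g) F x =
  - 4 * Q x - 2 * lambda * F x + 2 * energy g phi x.
Proof.
move=> Ux; rewrite (elliptic_norm_sq oU Cg gsym gpos Cphi Ux).
have -> : (\matrix_(i, j) rough_laplacian g phi i j x) =
    2 *: Rphi x + lambda *: phi x.
  apply/matrixP => i j.
  have -> : (2 *: Rphi x + lambda *: phi x) i j =
     2 * curvature_operator2 g phi i j x + lambda * phi x i j.
    have sE (X Y : 'M[R]_n) (a b : R) : (a *: X + b *: Y) i j = a * X i j + b * Y i j.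
      by rewrite !mxE.
    by rewrite sE; congr (_ * _ + _); rewrite mxE.
  rewrite -(eigen Ux) /einstein_operator [LHS]mxE.
  move: (rough_laplacian _ _ _ _ _) (curvature_operator2 _ _ _ _ _) => a b.
  by ring.
rewrite mulmxDr mulmxDl mxtraceD -!scalemxAr -!scalemxAl !mxtraceZ /norm_sq.
by move: (\tr _) (\tr _) (energy _ _ _) => a b c; ring.
Qed.

Lemma energy_phi_ge0 x : U x -> 0 <= energy g phi x.
Proof.
move=> Ux; apply: energy_ge0; [exact: gsym | exact: gpos | exact: cov_phi_sym].
Qed.

Lemma norm_sq_subharmonic x : U x -> 0 <= elliptic_op h (drift g) F x.
Proof.
move=> Ux; rewrite bochner //.
have := curvature_term_le0 Ux; have := energy_phi_ge0 Ux.
have := mulr_le0_ge0 lambda_le0 (norm_sq_ge0 Ux).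
by move: (Q x) (energy _ _ _) (F x) => q e f *; nra.
Qed.

(** When the norm is constant, each of the three nonnegative terms of the Bochner
    formula vanishes; so [phi] is parallel, hence an eigentensor of the curvature
    operator for [kappa > 0], although the curvature term is nonpositive. *)
Lemma constant_norm_vanishes x0 : U x0 -> (forall x, U x -> F x = F x0) -> F x0 = 0.
Proof.
move=> Ux0 Fc.
have p0 i x : U x -> partial i F x = 0.
  move=> Ux; rewrite (@eq_partial _ _ U oU F (fun=> F x0)) //.
  exact: partial_cst.
have L0 x : U x -> elliptic_op h (drift g) F x = 0.
  move=> Ux; rewrite /elliptic_op [X in _ + X]big1 ?addr0; last first.
    by move=> i _; rewrite p0 // mulr0.
  rewrite big1 // => i _; rewrite big1 // => j _.
  rewrite (@eq_partial _ _ U oU (partial j F) (fun=> 0)) //.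
    by rewrite partial_cst mulr0.
  by move=> y; exact: p0.
have T0 x k : U x -> cov_mx g phi k x = 0.
  move=> Ux; have e0 : energy g phi x = 0.
    have := bochner Ux; rewrite L0 //.
    have := curvature_term_le0 Ux; have := energy_phi_ge0 Ux.
    have := mulr_le0_ge0 lambda_le0 (norm_sq_ge0 Ux).
    by move: (Q x) (energy _ _ _) (F x) => q e f *; nra.
  exact: (energy_eq0 (gsym Ux) (gpos Ux) (cov_phi_sym Ux) e0).
have QE : Q x0 = kappa * F x0.
  have -> : Rphi x0 = kappa *: phi x0.
    apply/matrixP => i j; rewrite [LHS]mxE [RHS]mxE.
    exact: (parallel_curvature_operator oU Cg gsym gpos einstein (@Cphi 2)
      (fun y l => @T0 y l) Ux0).
  by rewrite -scalemxAr -scalemxAl mxtraceZ.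
have := curvature_term_le0 Ux0; rewrite QE pmulr_rle0 // => Fle.
by apply/eqP; rewrite eq_le Fle norm_sq_ge0.
Qed.

End LocalRigidity.

(** * From charts to the manifold *)

Lemma posdefmx_inv (R : realType) n (A : 'M[R]_n) : A^T = A -> posdefmx A ->
  posdefmx (invmx A).
Proof.
move=> Asym Apos v v0; have AU := posdefmx_unit Asym Apos.
have -> : v *m invmx A *m v^T = (v *m invmx A) *m A *m (v *m invmx A)^T.
  by rewrite mulmxKV // trmx_mul trmx_inv Asym mulmxA.
apply: Apos; apply: contra v0 => /eqP E.
by rewrite -(mulmxKV AU v) E mul0mx.
Qed.

(** The strong maximum principle makes the norm constant on a neighbourhood [V]
    of the maximum, and [constant_norm_vanishes] is applied on [V]. *)
Lemma norm_sq_at_max (R : realType) n (U : set 'rV[R]_n) (g phi : 'rV[R]_n -> 'M[R]_n)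
    (kappa Kmin lambda : R) (x0 : 'rV[R]_n) :
  open U -> (forall d, mxCk U d g) -> (forall x, U x -> (g x)^T = g x) ->
  (forall x, U x -> posdefmx (g x)) ->
  (forall d, mxCk U d phi) -> (forall x, U x -> (phi x)^T = phi x) ->
  (forall x, U x -> forall i j, ricci g i j x = kappa * g x i j) ->
  (forall x u v, U x -> orthonormal_pair g x u v -> Kmin <= sec g x u v) ->
  0 < kappa -> kappa <= n%:R * Kmin ->
  (forall x, U x -> trace2 g phi x = 0) ->
  (forall x, U x -> forall i j,
     einstein_operator g phi i j x = lambda * phi x i j) ->
  lambda <= 0 ->
  U x0 -> (forall x, U x -> norm_sq g phi x <= norm_sq g phi x0) ->
  norm_sq g phi x0 = 0.
Proof.
move=> oU Cg gsym gpos Cphi phisym ein KminP k0 kK tr0 eig l0 Ux0 Fmax.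
have Ch d := @cometric_Ck R n U oU g Cg gsym gpos d.
have Cdrift l : Ck U 0 (fun x => drift g x l).
  have C1 m k : Ck U 0 (fun x => cometric g x m k * christoffel g l m k x).
    have Cc := @connection_Ck R n U oU g Cg gsym gpos 0 m k l.
    have Cc' : Ck U 0 (christoffel g l m k).
      by apply: (eq_Ck oU) Cc => x _; rewrite mxE.
    exact (CkM oU (Ch 0 m k) Cc').
  have C2 m := @Ck_sum _ _ U oU 0 _ (index_enum _) _ (C1 m).
  exact (CkN oU (@Ck_sum _ _ U oU 0 _ (index_enum _) _ C2)).
have hsym x : U x -> (cometric g x)^T = cometric g x.
  exact: cometric_sym.
have hpos x : U x -> posdefmx (cometric g x).
  by move=> Ux; apply: posdefmx_inv; [exact: gsym | exact: gpos].
have CF : Ck U 2 (norm_sq g phi) by exact: norm_sq_Ck.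
have Lge x : U x -> 0 <= elliptic_op (cometric g) (drift g) (norm_sq g phi) x.
  exact: (norm_sq_subharmonic oU Cg gsym gpos Cphi phisym ein KminP kK tr0 eig l0).
have Fc := strong_maximum_principle oU (Ch 0) Cdrift hsym hpos Ux0 CF Fmax Lge.
pose V := U `&` interior [set y | norm_sq g phi y = norm_sq g phi x0].
have oV : open V by apply: openI => //; exact: open_interior.
have VU x : V x -> U x by case.
have Vx0 : V x0 by split.
have sub (A : 'rV[R]_n -> 'M[R]_n) : (forall d, mxCk U d A) -> forall d, mxCk V d A.
  by move=> CA d i j; apply: Ck_sub (CA d i j).
apply: (@constant_norm_vanishes R n V oV g phi (sub _ Cg) (fun x Vx => gsym x (VU x Vx))
  (fun x Vx => gpos x (VU x Vx)) (sub _ Cphi) (fun x Vx => phisym x (VU x Vx))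
  kappa Kmin lambda (fun x Vx => ein x (VU x Vx)) (fun x u v Vx => KminP x u v (VU x Vx))
  k0 kK (fun x Vx => tr0 x (VU x Vx)) (fun x Vx => eig x (VU x Vx)) l0 x0 Vx0).
by move=> x [_ /interior_subset].
Qed.

Section Global.
Context {R : realType} {n : nat} {M : topologicalType} {A : smooth_atlas R n M}.
Variable g : riemannian_metric A.
Implicit Types (phi : sym_tensor A).

Lemma open_cod (a : chart_index A) : open (cod a).
Proof. exact: cod_open. Qed.

Lemma tensor_mxCk phi a d : mxCk (cod a) d (phi a).
Proof. by move=> i j; apply: smooth_Ck; exact: stensor_smooth. Qed.

Lemma metric_posdefmx a x : cod a x -> posdefmx (g a x).
Proof. by move=> ax v; exact: metric_posdef. Qed.

Lemma metric_unit a x : cod a x -> g a x \in unitmx.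
Proof.
by move=> ax; apply: posdefmx_unit; [exact: stensor_sym | exact: metric_posdefmx].
Qed.

Lemma trace_sq_congruence (J G X : 'M[R]_n) : J *m G *m J^T \in unitmx ->
  \tr (invmx (J *m G *m J^T) *m (J *m X *m J^T) *m
       (invmx (J *m G *m J^T) *m (J *m X *m J^T))) =
  \tr (invmx G *m X *m (invmx G *m X)).
Proof.
move=> JGJ; have := JGJ; rewrite !unitmx_mul => /andP[/andP[JU GU] JTU].
have -> : invmx (J *m G *m J^T) *m (J *m X *m J^T)
   = invmx J^T *m (invmx G *m X) *m J^T.
  apply: (can_inj (mulKmx JGJ)); rewrite mulKVmx //.
  by rewrite !mulmxA !mulmxK.
move: (invmx G *m X) => Y.
by rewrite -!mulmxA mxtrace_mulC !mulmxA !mulmxK.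
Qed.

(** The transformation law is a congruence by the Jacobian matrix.  Its
    invertibility follows from that of the metric in the first chart, and traces
    of products of the mixed endomorphism [g^-1 phi] are invariant. *)
Lemma norm_sq_chart phi a b p : dom a p -> dom b p ->
  norm_sq (g a) (phi a) (chart a p) = norm_sq (g b) (phi b) (chart b p).
Proof.
move=> ap bp; have ca : cod a (chart a p) by exists p.
have gE := stensor_transform g ap bp; have phiE := stensor_transform phi ap bp.
have := metric_unit ca; rewrite /norm_sq /cometric /= phiE gE.
exact: trace_sq_congruence.
Qed.

Lemma scalar_einstein_constant a x (kappa : R) : cod a x ->
  (forall i j, ricci (g a) i j x = kappa * g a x i j) ->
  scalar_curvature (g a) x = n%:R * kappa.
Proof.
move=> ax ein.
transitivity (kappa * \tr (invmx (g a x) *m g a x)).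
  rewrite mulr_sumr; apply: eq_bigr => k _; rewrite mxE mulr_sumr.
  apply: eq_bigr => l _; rewrite ein -[in RHS](stensor_sym g ax) [_^T _ _]mxE.
  by rewrite stensor_sym // mulrCA.
by rewrite mulVmx ?metric_unit // mxtrace1 mulrC.
Qed.

Hypothesis compactM : compact [set: M].

Definition chart_at (p : M) : chart_index A := projT1 (cid (dom_cover A p)).

Lemma chart_atP p : dom (chart_at p) p.
Proof. by rewrite /chart_at; case: cid. Qed.

Definition norm_sq_at phi (p : M) : R :=
  norm_sq (g (chart_at p)) (phi (chart_at p)) (chart (chart_at p) p).

Lemma norm_sq_atE phi a p : dom a p ->
  norm_sq_at phi p = norm_sq (g a) (phi a) (chart a p).
Proof. by move=> ap; apply: norm_sq_chart => //; exact: chart_atP. Qed.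

Lemma norm_sq_at_continuous phi : continuous (norm_sq_at phi).
Proof.
move=> p; set a := chart_at p; have ap : dom a p := chart_atP p.
have ca : cod a (chart a p) by exists p.
have E : \forall q \near p, norm_sq (g a) (phi a) (chart a q) = norm_sq_at phi q.
  have : \forall q \near p, dom a q.
    by apply: open_nbhs_nbhs; split => //; exact: dom_open.
  by apply: filterS => q aq; rewrite (norm_sq_atE _ aq).
have gs x (ax : cod a x) : (g a x)^T = g a x := stensor_sym g ax.
have gp x (ax : cod a x) : posdefmx (g a x) := metric_posdefmx ax.
have Cn := @norm_sq_Ck R n (cod a) (@open_cod a) (g a) (phi a)
  (fun d => @tensor_mxCk g a d) gs gp (fun d => @tensor_mxCk phi a d) 0 _ ca.
have c : {for p, continuous (fun q => norm_sq (g a) (phi a) (chart a q))}.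
  by apply: continuous_comp => //; exact: chart_continuous.
rewrite /continuous_at /prop_for (norm_sq_atE phi ap).
exact: cvg_trans (near_eq_cvg E) c.
Qed.

Theorem eigentensor_vanishes (s Kmin lambda : R) phi :
  (2 <= n)%N -> is_einstein g -> has_scalar_curvature g s -> s != 0 ->
  is_min_sectional_curvature g Kmin -> s / n%:R ^+ 2 <= Kmin ->
  is_TT g phi -> lambda <= 0 ->
  (forall a x, cod a x -> forall i j,
     einstein_operator (g a) (phi a) i j x = lambda * phi a x i j) ->
  ~ nonzero_tensor phi.
Proof.
move=> n2 [kappa ein] scal s0 [_ Kmin_le] sK TT l0 eig [b [y [by_ phi0]]].
have n0 : 0 < n%:R :> R by rewrite ltr0n ltnW.
have KminP a x u v : cod a x -> orthonormal_pair (g a) x u v -> Kmin <= sec (g a) x u v.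
  by move=> ax uv; apply: Kmin_le; exists a, x, u, v.
have gs a x (ax : cod a x) : (g a x)^T = g a x := stensor_sym g ax.
have gp a x (ax : cod a x) : posdefmx (g a x) := metric_posdefmx ax.
have sE : s = n%:R * kappa.
  by rewrite -(scal b y by_); apply: scalar_einstein_constant => // i j; exact: ein.
have kK : kappa <= n%:R * Kmin.
  move: sK; rewrite sE ler_pdivrMr ?exprn_gt0 // => sK.
  rewrite -(ler_pM2l n0); apply: le_trans sK _.
  by rewrite le_eqVlt; apply/orP; left; apply/eqP; ring.
have k0 : 0 < kappa.
  have kneq0 : kappa != 0 by move: s0; rewrite sE mulf_eq0 negb_or => /andP[].
  rewrite lt_neqAle eq_sym kneq0 /=.
  have a12 i j k l : curvature04 (g b) i j k l y = - curvature04 (g b) j i k l y.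
    exact: (curvature04_anti12 (@open_cod b) (@tensor_mxCk g b) (gs b) (gp b)).
  have ein4 k l : \sum_i \sum_q invmx (g b y) i q * curvature04 (g b) q k i l y
      = kappa * g b y k l.
    by rewrite (ricci_curvature04 (gs b) (gp b)) // ein.
  have KP u v : (u *m g b y *m u^T) ord0 ord0 = 1 ->
      (v *m g b y *m v^T) ord0 ord0 = 1 -> (u *m g b y *m v^T) ord0 ord0 = 0 ->
      Kmin <= sec_form (fun i j k l => curvature04 (g b) i j k l y) u v.
    by move=> uu vv uv; apply: (KminP b y u v by_).
  have := einstein_constant_ge a12 (gs b y by_) ein4 KP (ltnW n2) (gp b y by_).
  have -> : n.-1%:R = n%:R - 1 :> R by rewrite -subn1 natrB // ltnW.
  have n1 : 0 <= n%:R - 1 :> R by rewrite subr_ge0 ler1n ltnW.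
  move=> H1; have := ler_wpM2l (ltW n0) H1; have := ler_wpM2l n1 kK; lra.
have [p _ pmax] := compact_EVT_max (ex_intro _ (chart_inv b y) I) compactM
  (continuous_subspaceT (@norm_sq_at_continuous phi)).
have ap := chart_atP p; set a := chart_at p in ap.
have F0 : norm_sq_at phi p = 0.
  rewrite (norm_sq_atE phi ap).
  apply: (@norm_sq_at_max R n (cod a) (g a) (phi a) kappa Kmin lambda) => //.
  - exact: open_cod.
  - by move=> d; exact: tensor_mxCk.
  - exact: gs.
  - exact: gp.
  - by move=> d; exact: tensor_mxCk.
  - by move=> x ax; exact: stensor_sym.
  - by move=> x ax; exact: ein.
  - by move=> x u v; exact: KminP.
  - by move=> x ax; have [] := TT a x ax.
  - by move=> x ax; exact: eig.
  - by exists p.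
  - move=> x [q aq <-]; rewrite -!norm_sq_atE //.
    by apply: pmax; rewrite inE.
have [q bq qy] := by_.
have Fq : norm_sq_at phi q <= 0 by rewrite -F0; apply: pmax; rewrite inE.
move: Fq; rewrite (norm_sq_atE phi bq) qy => Fq.
have phis : (phi b y)^T = phi b y by exact: stensor_sym.
have F1 : norm_sq (g b) (phi b) y = 0.
  apply/eqP; rewrite eq_le Fq /=; exact: trace_sq_ge0 (gs b y by_) (gp b y by_) phis.
by move/eqP: phi0; apply; exact: trace_sq_eq0 (gs b y by_) (gp b y by_) phis F1.
Qed.

End Global.

Unset Implicit Arguments.

Theorem theorem4p1 (R : realType) (n : nat) (M : topologicalType)
    (A : smooth_atlas R n M) (g : riemannian_metric A) (s Kmin : R)
    (hn : (2 <= n)%N)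
    (hausM : hausdorff_space M) (compactM : compact [set: M])
    (einstein_g : is_einstein g)
    (hs : has_scalar_curvature g s) (s_neq0 : s != 0)
    (hKmin : is_min_sectional_curvature g Kmin)
    (Kmin_ge : s / n%:R ^+ 2 <= Kmin) :
  ~ unstable g /\
  ~ (exists phi : sym_tensor A,
       infinitesimal_einstein_deformation g phi /\ nonzero_tensor phi).
Proof.
split.
  case=> lambda lambda_lt0 [phi [TT phi0 eig]]; move: phi0.
  exact: (eigentensor_vanishes compactM hn einstein_g hs s_neq0 hKmin Kmin_ge TT
    (ltW lambda_lt0) eig).
case=> phi [[TT eig]]; apply: (eigentensor_vanishes compactM hn einstein_g hs
  s_neq0 hKmin Kmin_ge TT (lexx 0)).
by move=> a x ax i j; rewrite mul0r; exact: eig.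
Qed.
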